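(* Let $k \geq 1$ be an integer, let $n = 16+6k$, and define three involutions in the symmetric group $S_n$ by $$\rho_1 = (1,2)\prod_{i=0}^{k}(4+6i,7+6i)\prod_{i=0}^{k}(5+6i,8+6i)\,(9+6k,12+6k)(10+6k,16+6k),$$ $$\rho_2 = (1,3)\prod_{i=0}^{k}(2+6i,5+6i)\prod_{i=0}^{k}(6+6i,9+6i)\,(8+6k,14+6k)(10+6k,13+6k),$$ $$\rho_3 = (1,4)\prod_{i=0}^{k}(3+6i,6+6i)\prod_{i=0}^{k}(7+6i,10+6i)\,(8+6k,11+6k)(9+6k,15+6k).$$ Let $G = \langle \rho_1,\rho_2,\rho_3\rangle$, $G_1 = \langle \rho_2,\rho_3\rangle$, $G_2 = \langle \rho_1,\rho_3\rangle$, $G_3 = \langle \rho_1,\rho_2\rangle$, and let $\Gamma = \Gamma(G,\{G_1,G_2,G_3\})$ be the associated coset geometry. Then: (a) $\Gamma$ is thin, flag transitive and residually connected; (b) $\mathrm{Aut}(\Gamma)\cong G\cong S_n$, and the action on $\Gamma$ is faithful; (c) $\Gamma$ admits trialities but no dualities; (d) the size of the maximal parabolics $G_1,G_2,G_3$ grows essentially linearly with $n$.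
   Context: An incidence system over a finite nonempty type set $I$ is a triple $(X,\star,t)$ with $X$ a nonempty set of elements, $t:X\to I$ a type map, and $\star$ a symmetric reflexive relation on $X$ (incidence) such that distinct incident elements have different types. A flag is a set of pairwise incident elements; its type is the set of types of its elements; a chamber is a flag of type $I$. The incidence system is a geometry if every maximal flag is a chamber. The residue of a flag $F$ is the incidence system formed by the elements not in $F$ that are incident to all elements of $F$; its rank is $|I|-|F|$. A geometry is thin if every flag of type $I\setminus\{i\}$, $i\in I$, is contained in exactly two chambers. It is residually connected if the incidence graph (vertices: elements; edges: pairs of distinct incident elements) of every residue of rank at least $2$ (including the whole geometry, the residue of the empty flag) is connected. A correlation is a bijection $\phi:X\to X$ with $x\star y \iff \phi(x)\star\phi(y)$ and such that $t(x)=t(y)$ implies $t(\phi(x))=t(\phi(y))$; it induces a permutation of $I$, called its type. An automorphism is a correlation preserving all types; $\mathrm{Aut}(\Gamma)$ is the group of automorphisms. A duality is a correlation whose type is a transposition $(i,j)$; a triality is a correlation whose type is a 3-cycle $(i,j,k)$. A geometry is flag transitive if $\mathrm{Aut}(\Gamma)$ is transitive on its chambers. For a group $G$ and subgroups $(G_i)_{i\in I}$, the coset geometry $\Gamma(G,(G_i)_{i\in I})$ has as elements of type $i$ the left cosets $xG_i$, $x\in G$; cosets $xG_i$ and $yG_j$ with $i\neq j$ are incident iff $xG_i\cap yG_j\neq\emptyset$ (and each element is incident to itself). $G$ acts on it by left multiplication. The subgroups $G_i$ are called the maximal parabolics. *)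

(* Defs.v *)
From HB Require Import structures.
From mathcomp Require Import all_boot all_fingroup.

Set Implicit Arguments.
Unset Strict Implicit.
Unset Printing Implicit Defensive.

Import GroupScope.

Record incidence_system (I : finType) := IncidenceSystem {
  elt :> finType;
  etype : elt -> I;
  incident : rel elt;
  elt_gt0 : 0 < #|elt|;
  incident_refl : reflexive incident;
  incident_sym : symmetric incident;
  incident_type : forall x y, incident x y -> x != y -> etype x != etype y
}.

Section Incidence.

Variables (I : finType) (S : incidence_system I).
Implicit Types (F C A : {set S}) (phi : {perm S}) (tau : {perm I}).

Definition flag F : bool := [forall x in F, forall y in F, incident x y].

Definition type_of F : {set I} := [set etype x | x in F].

Definition chamber F : bool := flag F && (type_of F == [set: I]).

Definition is_geometry : Prop := forall F, maxset flag F -> chamber F.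

Definition residue F : {set S} :=
  [set x | (x \notin F) && [forall y in F, incident x y]].

Definition residue_rank F : nat := #|I| - #|F|.

Definition incidence_graph A : rel S :=
  [rel x y | [&& x \in A, y \in A, x != y & incident x y]].

Definition connected_on A : Prop :=
  {in A &, forall x y, connect (incidence_graph A) x y}.

Definition residually_connected : Prop :=
  forall F, flag F -> 2 <= residue_rank F -> connected_on (residue F).

Definition thin : Prop :=
  forall (i : I) F, flag F -> type_of F = [set~ i] ->
    #|[set C | chamber C & F \subset C]| = 2.

Definition correlation phi : bool :=
  [forall x, forall y, incident (phi x) (phi y) == incident x y]
  && [forall x, forall y,
       (etype x == etype y) ==> (etype (phi x) == etype (phi y))].

(* In a geometry every type occurs, so tau is then determined by phi. *)
Definition correlation_type phi tau : Prop :=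
  forall x, etype (phi x) = tau (etype x).

Definition three_cycle tau (i j k : I) : Prop :=
  [/\ uniq [:: i; j; k], tau i = j, tau j = k, tau k = i
    & forall l, l \notin [:: i; j; k] -> tau l = l].

Definition duality phi : Prop :=
  correlation phi /\
  exists i j : I, i != j /\ correlation_type phi (tperm i j).

Definition triality phi : Prop :=
  correlation phi /\
  exists tau (i j k : I), three_cycle tau i j k /\ correlation_type phi tau.

Definition Autg : {set {perm S}} :=
  [set phi | correlation phi & [forall x, etype (phi x) == etype x]].

Lemma AutgP phi :
  reflect ((forall x y, incident (phi x) (phi y) = incident x y)
           /\ (forall x, etype (phi x) = etype x))
          (phi \in Autg).
Proof.
rewrite inE; apply: (iffP andP) => [[/andP[/forallP Hi _] /forallP Ht]|[Hi Ht]].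
  by split=> [x y|x]; apply/eqP; [move/forallP: (Hi x) | apply: Ht].
split; last by apply/forallP=> x; rewrite Ht.
apply/andP; split; apply/forallP=> x; apply/forallP=> y; first by rewrite Hi.
by rewrite !Ht implybb.
Qed.

Lemma group_set_Autg : group_set Autg.
Proof.
apply/group_setP; split; first by apply/AutgP; split=> *; rewrite !perm1.
move=> u v /AutgP[iu tu] /AutgP[iv tv].
by apply/AutgP; split=> *; rewrite !permM ?iv ?iu ?tv ?tu.
Qed.

Canonical Autg_group := Group group_set_Autg.

Definition flag_transitive : Prop :=
  [transitive Autg, on [set C | chamber C] | 'P^*].

End Incidence.

Section CosetGeometry.

Variables (gT : finGroupType) (I : finType) (I_gt0 : 0 < #|I|).
Variables (G : {group gT}) (H : I -> {group gT}).

(* An element of type i is a pair (i, C) with C a left coset of H i in G; the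
   label keeps elements of different types distinct even when the underlying
   cosets coincide. *)
Definition coset_elt : finType :=
  {p : I * {set gT} | p.2 \in lcosets (H p.1) G}.

Definition coset_etype (x : coset_elt) : I := (val x).1.
Definition coset_val (x : coset_elt) : {set gT} := (val x).2.

Definition coset_incident : rel coset_elt := [rel x y |
  (x == y)
  || (coset_etype x != coset_etype y)
     && (coset_val x :&: coset_val y != set0)].

Lemma coset_elt_gt0 : 0 < #|coset_elt|.
Proof.
case/card_gt0P: I_gt0 => i _.
have p_in : (i, H i : {set gT}).2 \in lcosets (H (i, H i : {set gT}).1) G.
  by apply/lcosetsP; exists 1; rewrite ?group1 ?lcoset1.
by apply/card_gt0P; exists (Sub (i, H i : {set gT}) p_in).
Qed.

Lemma coset_incident_refl : reflexive coset_incident.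
Proof. by move=> x; rewrite /coset_incident /= eqxx. Qed.

Lemma coset_incident_sym : symmetric coset_incident.
Proof.
move=> x y; rewrite /coset_incident /= eq_sym; congr (_ || _).
by rewrite eq_sym setIC.
Qed.

Lemma coset_incident_type x y :
  coset_incident x y -> x != y -> coset_etype x != coset_etype y.
Proof. by case/orP=> [/eqP->|/andP[]//]; rewrite eqxx. Qed.

Definition coset_geometry : incidence_system I :=
  IncidenceSystem coset_elt_gt0 coset_incident_refl coset_incident_sym
                  coset_incident_type.

(* Left multiplication by G. Actions in MathComp are right actions, so a acts
   by left multiplication by a^-1. The action has domain G, and the value for
   a outside G is irrelevant. *)
Definition coset_mul (x : coset_elt) (a : gT) : coset_elt :=
  if a \in G then insubd x (coset_etype x, a^-1 *: coset_val x) else x.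

Lemma val_coset_mul x a : a \in G ->
  val (coset_mul x a) = (coset_etype x, a^-1 *: coset_val x).
Proof.
move=> Ga; rewrite /coset_mul Ga val_insubd ifT //=.
have /lcosetsP[b Gb] := valP x; rewrite /coset_val => ->.
by apply/lcosetsP; exists (a^-1 * b); rewrite ?groupM ?groupV // lcosetM.
Qed.

Lemma coset_mul_is_action : is_action G coset_mul.
Proof.
split=> [a x y|x a b Ga Gb]; last first.
  apply: val_inj; rewrite !val_coset_mul ?groupM // /coset_etype /coset_val.
  by rewrite !val_coset_mul //= invMg lcosetM.
case Ga: (a \in G); last by rewrite /coset_mul Ga.
move/(congr1 val); rewrite !val_coset_mul // => -[et ev].
by apply: val_inj; rewrite [val x]surjective_pairing [val y]surjective_pairing;
  congr (_, _) => //; apply: (can_inj (lcosetK a^-1)).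
Qed.

Canonical coset_mul_action := Action coset_mul_is_action.

End CosetGeometry.

Definition deg (k : nat) : nat := (16 + 6 * k)%N.

(* The letter m of {1, ..., n} is the ordinal m - 1. *)
Definition letter (k m : nat) : 'I_(deg k) := @inord (15 + 6 * k)%N m.-1.

Definition transp (k a b : nat) : 'S_(deg k) :=
  tperm (letter k a) (letter k b).

(* The transpositions in each product are pairwise disjoint, so MathComp's
   left-to-right composition of permutations plays no role here. *)
Definition rho1 (k : nat) : 'S_(deg k) :=
  transp k 1 2
  * (\prod_(i < k.+1) transp k (4 + 6 * i) (7 + 6 * i))
  * (\prod_(i < k.+1) transp k (5 + 6 * i) (8 + 6 * i))
  * transp k (9 + 6 * k) (12 + 6 * k)
  * transp k (10 + 6 * k) (16 + 6 * k).

Definition rho2 (k : nat) : 'S_(deg k) :=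
  transp k 1 3
  * (\prod_(i < k.+1) transp k (2 + 6 * i) (5 + 6 * i))
  * (\prod_(i < k.+1) transp k (6 + 6 * i) (9 + 6 * i))
  * transp k (8 + 6 * k) (14 + 6 * k)
  * transp k (10 + 6 * k) (13 + 6 * k).

Definition rho3 (k : nat) : 'S_(deg k) :=
  transp k 1 4
  * (\prod_(i < k.+1) transp k (3 + 6 * i) (6 + 6 * i))
  * (\prod_(i < k.+1) transp k (7 + 6 * i) (10 + 6 * i))
  * transp k (8 + 6 * k) (11 + 6 * k)
  * transp k (9 + 6 * k) (15 + 6 * k).

Definition G (k : nat) : {group 'S_(deg k)} :=
  <<[set rho1 k; rho2 k; rho3 k]>>%G.

Definition G1 (k : nat) : {group 'S_(deg k)} := <<[set rho2 k; rho3 k]>>%G.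
Definition G2 (k : nat) : {group 'S_(deg k)} := <<[set rho1 k; rho3 k]>>%G.
Definition G3 (k : nat) : {group 'S_(deg k)} := <<[set rho1 k; rho2 k]>>%G.

(* Types 1, 2, 3 are the ordinals 0, 1, 2. *)
Definition parabolic (k : nat) (i : 'I_3) : {group 'S_(deg k)} :=
  nth (G1 k) [:: G1 k; G2 k; G3 k] i.

Lemma card_I3_gt0 : 0 < #|'I_3|.
Proof. by rewrite card_ord. Qed.

Definition Gamma (k : nat) : incidence_system 'I_3 :=
  coset_geometry card_I3_gt0 (G k) (parabolic k).

Definition Gamma_action (k : nat) : action (G k) (Gamma k) :=
  coset_mul_action (G k) (parabolic k).

(* Main.v *)
Require Import Defs.
From mathcomp Require Import all_boot all_order all_fingroup all_algebra.
From mathcomp Require Import cyclic.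
From mathcomp Require Import zify ring lra.

(* The permutation graph of rho_1, rho_2, rho_3 is a tripod with centre 1:
   three arms, each a path whose edges alternate between two labels
   and which ends in a fork. Rotating the arms conjugates rho_i to rho_(i+1),
   hence the triality. Two of the generators act on one long path through the
   centre as a dihedral group of degree m = 2k + 6, and all their other orbits
   have length at most 3; so a parabolic has order between m and 6m. The three
   long paths meet only next to the centre, and following the images of the
   points there shows that G_i meets G_j G_l in (G_i :&: G_j)(G_i :&: G_l),
   which is the condition for flag transitivity; the intersections of two
   parabolics have order 2, which gives thinness.
   The sixth power of a product of two generators is supported on a long path,
   so that an iterated commutator T of such powers is a 3-cycle. Being equal or
   in a common 3-cycle of G is a G-invariant equivalence relation, which turns
   out to be total, and rho_1 is odd; hence G = S_n.
   A duality would turn every relation between the generators into a relation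
   after exchanging two of them. This exchange turns T into another 3-cycle T',
   whose points are placed differently, and a reflection u of the long path
   swaps two points of T, while its counterpart u' moves the support of T' away
   from the centre; a relation between T and T ^ u fails for T' and T' ^ u'. *)

Set Implicit Arguments.
Unset Strict Implicit.
Unset Printing Implicit Defensive.

Import GroupScope GRing.Theory Num.Theory.
Local Open Scope nat_scope.

Ltac split_ifs := repeat (match goal with
  | |- context [if ?b then _ else _] =>
    lazymatch b with context [if _ then _ else _] => fail | _ => idtac end;
    let e := fresh "e" in case e : b
  end; try (exfalso; lia)).

Ltac ord_absurd n1 n2 n3 := let e := fresh "e" in move=> e; exfalso;
  first [by rewrite e eqxx in n1 | by rewrite e eqxx in n2 | by rewrite e eqxx in n3
        |by rewrite -e eqxx in n1 | by rewrite -e eqxx in n2 | by rewrite -e eqxx in n3].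

(** * Types as residues modulo 3 *)

Lemma ord3_cases (s t : 'I_3) : [\/ t = s, t = (s + 1)%R | t = (s + 2)%R].
Proof.
case: s t => [[|[|[|//]]]] ? [[|[|[|//]]]] ?.
all: (by constructor 1; apply: val_inj) || (by constructor 2; apply: val_inj) ||
  (by constructor 3; apply: val_inj).
Qed.

Lemma ord3_neq (s : 'I_3) :
  [/\ (s + 1 != s)%R, (s + 2 != s)%R & (s + 2 != s + 1)%R].
Proof. by case: s => [[|[|[|//]]]] ?; split. Qed.

Lemma ord3_add (s : 'I_3) :
  (((s + 1 + 1 = s + 2)%R * (s + 1 + 2 = s)%R) * ((s + 2 + 1 = s)%R * (s + 2 + 2 = s + 1)%R))%type.
Proof. by case: s => [[|[|[|//]]]] ?; do !split; apply: val_inj. Qed.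

Lemma gen_stable (T : finType) (A : {set {perm T}}) (S : T -> Prop) (g : {perm T}) x :
  (forall h y, h \in A -> S y -> S (h y)) -> g \in <<A>>%g -> S x -> S (g x).
Proof.
move=> hA /gen_prodgP[n [c hc ->]]; elim: n c hc x => [|n IH] c hc x Sx.
  by rewrite big_ord0 perm1.
by rewrite big_ord_recl permM; apply: IH => [i|]; [exact: hc | apply: hA].
Qed.

(** * Groups generated by two involutions *)

Section Dihedral.
Variables (gT : finGroupType) (x y : gT).
Hypotheses (x2 : (x * x = 1)%g) (y2 : (y * y = 1)%g).

Lemma invol_inv : (x^-1 = x)%g.
Proof. by apply: (mulgI x); rewrite mulgV x2. Qed.

(** [x] inverts [y * x], so the product of the two cyclic groups is a group; it contains [x] and
    [y = (y * x) * x]. *)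
Lemma dihedral_gen_sub : (<<[set x; y]>> \subset <[y * x]> * <[x]>)%g.
Proof.
have yV : (y^-1 = y)%g by apply: (mulgI y); rewrite mulgV y2.
have nx : (<[x]> \subset 'N(<[y * x]>))%g.
  rewrite cycle_subG; apply/normP; rewrite -cycleJ -[RHS]cycleV; congr (<[_]>)%g.
  by rewrite conjgE invMg invol_inv yV -!mulgA x2 mulg1.
rewrite -(norm_joinEr nx) gen_subG; apply/subsetP => z /set2P[] ->.
  by rewrite mem_gen // inE cycle_id orbT.
suff: (y * x * x)%g \in <[y * x]> <*> <[x]> by rewrite -mulgA x2 mulg1.
by apply: groupM; apply: mem_gen; rewrite inE cycle_id ?orbT.
Qed.

Lemma dihedral_genP g : g \in <<[set x; y]>>%g ->
  exists n, g = ((y * x) ^+ n)%g \/ g = ((y * x) ^+ n * x)%g.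
Proof.
move/(subsetP dihedral_gen_sub)/mulsgP => [_ _ /cycleP[n ->] /cycleP[p ->] ->].
exists n; rewrite -(odd_double_half p) expgD -muln2 mulnC expgM expgS expg1 x2 expg1n mulg1.
by case: (odd p); [right | left; rewrite mulg1].
Qed.

Lemma dihedral_card : (#|<<[set x; y]>>%g| <= #[(y * x)%g] * 2)%N.
Proof.
apply: leq_trans (subset_leq_card dihedral_gen_sub) _.
have := mul_cardG <[y * x]>%G <[x]>%G => /= e.
have ox : #[x] <= 2 by rewrite dvdn_leq // order_dvdn expgS expg1 x2.
have : #|(<[y * x]> * <[x]>)%g| <= #|<[y * x]>%g| * #|<[x]>%g|.
  by rewrite e leq_pmulr ?cardG_gt0.
by move/leq_trans; apply; rewrite leq_mul2l ox orbT.
Qed.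

End Dihedral.

Ltac sneq := first [assumption | rewrite eq_sym; assumption].

(** * 3-cycles and the alternating group *)

Section ThreeCycles.
Local Open Scope group_scope.
Variable T : finType.
Implicit Types (x y z u v w : T) (g h : {perm T}).

(** As products act from left to right, this is x -> y -> z -> x. *)
Definition cycle3 x y z : {perm T} := tperm x y * tperm x z.

Lemma cycle3J x y z g : cycle3 x y z ^ g = cycle3 (g x) (g y) (g z).
Proof. by rewrite conjMg !tpermJ. Qed.

Lemma cycle3V x y z : (cycle3 x y z)^-1 = cycle3 x z y.
Proof. by rewrite invMg !tpermV. Qed.

Lemma cycle3_id x y z u : u != x -> u != y -> u != z -> cycle3 x y z u = u.
Proof. by move=> ux uy uz; rewrite permM !tpermD; try sneq. Qed.

Lemma cycle3_1 x y z : y != x -> y != z -> cycle3 x y z x = y.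
Proof. by move=> yx yz; rewrite permM tpermL tpermD; try sneq. Qed.

Lemma cycle3_2 x y z : cycle3 x y z y = z.
Proof. by rewrite permM tpermR tpermL. Qed.

Lemma cycle3_3 x y z : z != x -> z != y -> cycle3 x y z z = x.
Proof. by move=> zx zy; rewrite permM [tperm x y z]tpermD ?tpermR; try sneq. Qed.

Lemma cycle3C x y z : x != y -> y != z -> x != z -> cycle3 x y z = cycle3 y z x.
Proof.
move=> xy yz xz; apply/permP => u.
case: (eqVneq u x) => [->|ux]; first by rewrite cycle3_1 ?cycle3_3; try sneq.
case: (eqVneq u y) => [->|uy]; first by rewrite cycle3_2 cycle3_1; try sneq.
case: (eqVneq u z) => [->|uz]; first by rewrite cycle3_2 cycle3_3; try sneq.
by rewrite !cycle3_id.
Qed.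

Variable G : {group {perm T}}.

Definition linked x y : Prop :=
  x = y \/ exists z, [/\ x != y, z != x, z != y & cycle3 x y z \in G].

Lemma cycle3_flip x y z : x != y -> y != z -> x != z ->
  cycle3 x y z \in G -> cycle3 y x z \in G.
Proof.
move=> xy yz xz; rewrite -groupV cycle3V cycle3C; try sneq.
by rewrite cycle3C; try sneq.
Qed.

Lemma linked_sym x y : linked x y -> linked y x.
Proof.
case=> [->|[z [xy zx zy h]]]; first by left.
by right; exists z; split; try sneq; apply: cycle3_flip; try sneq.
Qed.

(** In general position, conjugation by a 3-cycle y -> w -> v fixes [x] and moves [y] to [w]. When
    [z = w] or [v = x], one of the two given 3-cycles already contains both [x] and [w]. *)
Lemma linked_trans x y w : linked x y -> linked y w -> linked x w.
Proof.
case=> [->//|[z [xy zx zy hz]]] [<-|[v [yw vy vw hv]]].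
  by right; exists z.
case: (eqVneq x w) => [->|xw]; first by left.
case: (eqVneq z w) => [e|zw].
  right; exists y; rewrite -e in xw yw *; split; try sneq.
  by rewrite -groupV cycle3V.
case: (eqVneq x v) => [e|xv].
  right; exists y; rewrite -e in vy vw hv *; split; try sneq.
  by rewrite -groupV cycle3V cycle3C; try sneq; rewrite cycle3C; try sneq; apply: cycle3_flip; try sneq.
right; exists (cycle3 y w v z); split=> //.
- by rewrite -[X in _ != X](@cycle3_id y w v) ?(inj_eq perm_inj).
- by rewrite -[X in _ != X](@cycle3_1 y w v) ?(inj_eq perm_inj); try sneq.
have := groupJ hz hv; rewrite cycle3J cycle3_id ?cycle3_1; try sneq; exact.
Qed.

Lemma linked_act g x y : g \in G -> linked x y -> linked (g x) (g y).
Proof.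
move=> gG [->|[z [xy zx zy h]]]; first by left.
right; exists (g z); rewrite !(inj_eq perm_inj); split=> //.
by rewrite -cycle3J groupJ.
Qed.

(** A 3-cycle on [x], [y], [u] is conjugated by one on [u], [z], [v], which replaces [u] by [z]. If
    [v] is [x] or [y], conjugation by the inverse yields the inverse of the wanted cycle. *)
Lemma linked_cycle3 : (forall x y, linked x y) -> forall x y z, x != y -> y != z -> x != z ->
  cycle3 x y z \in G.
Proof.
move=> L x y z xy yz xz; case: (L x y) => [e|[u [_ ux uy hu]]]; first by rewrite e eqxx in xy.
case: (eqVneq u z) => [<- //|uz].
case: (L u z) => [e|[v [_ vu vz hv]]]; first by rewrite e eqxx in uz.
case: (eqVneq v x) => [e|vx].
  rewrite e in vu vz hv; have := groupJ hu (groupVr hv); rewrite cycle3V cycle3J.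
  rewrite cycle3_2 cycle3_id ?cycle3_1; try sneq; rewrite -groupV cycle3V => h.
  by rewrite cycle3C; try sneq; rewrite cycle3C; try sneq.
case: (eqVneq v y) => [e|vy].
  rewrite e in vu vz hv; have := groupJ hu (groupVr hv); rewrite cycle3V cycle3J.
  by rewrite cycle3_2 cycle3_id ?cycle3_1; try sneq; rewrite -groupV cycle3V.
by have := groupJ hu hv; rewrite cycle3J (@cycle3_id u z v x) ?(@cycle3_id u z v y) ?cycle3_1; try sneq.
Qed.

Lemma linked_even : (forall x y, linked x y) -> forall s : {perm T}, ~~ odd_perm s -> s \in G.
Proof.
move=> L s; case: (pickP T) => [o _|no]; last first.
  by move=> _; suff -> : s = 1 by []; apply/permP => x; have := no x.
(* Induction on a product of transpositions through a base point [o]: an odd product is corrected by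
   one more such transposition, and two of them compose to a 3-cycle or to 1. *)
pose P s := if odd_perm s then exists x, x != o /\ tperm o x * s \in G else s \in G.
suff : P s by rewrite /P; case: ifP.
have : s \in <<[set tperm o y | y in T]>> by rewrite gen_tperm inE.
case/gen_prodgP => n [c hc ->]; elim: n c hc => [|n IH] c hc.
  by rewrite big_ord0 /P odd_perm1 group1.
rewrite big_ord_recl; have /imsetP[y _ ->] := hc ord0.
have := IH (fun j => c (lift ord0 j)) (fun j => hc _).
set s' := \prod_(_ < n) _; rewrite /P odd_permM odd_tperm.
case: (eqVneq o y) => [<-|oy] /=; first by rewrite tperm1 mul1g.
case: ifP => [_ [x [xo h]]|_ h] /=; last first.
  by exists y; rewrite eq_sym mulgA tperm2 mul1g.
rewrite -(mulKg (tperm o x) s') tpermV mulgA groupM //.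
case: (eqVneq x y) => [->|xy]; first by rewrite tperm2 group1.
by apply: linked_cycle3; rewrite // eq_sym.
Qed.

Lemma linked_full : (forall x y, linked x y) -> forall g, g \in G -> odd_perm g ->
  G = [set: {perm T}] :> {set {perm T}}.
Proof.
move=> L g gG og; apply/setP => s; rewrite inE.
case: (boolP (odd_perm s)) => os; last exact: linked_even.
rewrite -(mulKVg g s) groupM // linked_even // odd_permM odd_permV og.
by rewrite os.
Qed.

(** The supports meet in [p] alone, so each map fixes the image and the preimage of [p] under the
    other; the commutator then moves only [p], [h p] and [g p]. *)
Lemma commg_cycle3 g h p :
  (forall q, q != p -> g q = q \/ h q = q) -> g p != p -> h p != p ->
  [~ g, h] = cycle3 p (h p) (g p).
Proof.
move=> gh gp hp.
have g_h q : h q != q -> q != p -> g q = q.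
  by move=> hq /gh[] // e; rewrite e eqxx in hq.
have h_g q : g q != q -> q != p -> h q = q.
  by move=> hq /gh[] // e; rewrite e eqxx in hq.
have inv (f : {perm T}) q : f q = q -> f^-1 q = q by move=> e; rewrite -{1}e permK.
have invn (f : {perm T}) q : f^-1 q != q -> f q != q.
  by apply: contraNneq => e; rewrite inv.
have ghp : g (h p) = h p by apply: g_h; rewrite ?(inj_eq perm_inj).
have hgp : h (g p) = g p by apply: h_g; rewrite ?(inj_eq perm_inj).
have pV (f : {perm T}) : f p != p -> f^-1 p != p.
  by move=> fp; apply: contraNneq fp => e; rewrite -{1}e permKV.
have hgV : h (g^-1 p) = g^-1 p by apply: h_g; rewrite ?permKV ?pV // eq_sym pV.
have ghV : g (h^-1 p) = h^-1 p by apply: g_h; rewrite ?permKV ?pV // eq_sym pV.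
have hgn : h p != g p.
  by apply: contraNneq hp => e; apply/eqP/(@perm_inj _ g); rewrite ghp e.
apply/permP => q; rewrite commgEl conjgE permM permM permM.
case: (eqVneq q p) => [->|qp].
  by rewrite cycle3_1 // (inv h) // permKV.
case: (eqVneq q (h p)) => [->|qh].
  by rewrite cycle3_2 (inv g) // permK hgp.
case: (eqVneq q (g p)) => [->|qg].
  by rewrite permK ghV permKV cycle3_3 // eq_sym.
rewrite cycle3_id //.
case: (gh q qp) => e.
  rewrite (inv g) //; have := gh (h^-1 q); case.
  - by apply: contraNneq qh => <-; rewrite permKV.
  - by move=> ->; rewrite permKV.
  by rewrite permKV => e'; rewrite -e' e {1}e' permKV.
have e1 : h (g^-1 q) = g^-1 q.
  case: (eqVneq (g^-1 q) q) => [->//|gq].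
  by apply: h_g; [rewrite permKV eq_sym | apply: contraNneq qg => <-; rewrite permKV].
by rewrite (inv h) // permKV.
Qed.

End ThreeCycles.
(** The supports of [X] and [Y] meet in [p] and [q] at most, so their commutator moves only these
    points and their images under [X] and [Y]. Of these, [W] moves only [p], and [commg_cycle3]
    applies. *)
Lemma commg_commg_cycle3 (T : finType) (X Y W : {perm T}) (p q : T) :
  (forall u, u != p -> u != q -> X u = u \/ Y u = u) ->
  (forall u, u \in [:: q; X p; X q; Y p; Y q] -> u != p -> W u = u) ->
  X ((Y^-1)%g p) = (Y^-1)%g p -> X p != p -> W p != p ->
  [~ [~ Y, X], W]%g = cycle3 p (W p) (X p).
Proof.
move=> XY hW XYp Xp Wp.
have inv (f : {perm T}) u : f u = u -> (f^-1)%g u = u by move=> e; rewrite -{1}e permK.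
have gE u : [~ Y, X]%g u = X (Y ((X^-1)%g ((Y^-1)%g u))).
  by rewrite commgEl conjgE permM permM permM.
have gp : [~ Y, X]%g p = X p by rewrite gE (inv X) // permKV.
rewrite -gp; apply: commg_cycle3; rewrite ?gp // => u up.
case: (boolP (u \in [:: q; X p; X q; Y p; Y q])) => hu; first by right; apply: hW.
left; move: hu; rewrite !inE !negb_or => /and5P[uq uXp uXq uYp uYq].
have XYu t : t != p -> t != q -> X t != t -> Y t = t.
  by move=> tp tq Xt; case: (XY t tp tq) => // e; rewrite e eqxx in Xt.
have YXu t : t != p -> t != q -> Y t != t -> X t = t.
  by move=> tp tq Yt; case: (XY t tp tq) => // e; rewrite e eqxx in Yt.
have Vn (f : {perm T}) t : u != f t -> (f^-1)%g u != t.
  by apply: contraNneq => <-; rewrite permKV.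
rewrite gE; case: (eqVneq (Y u) u) => Yu; last first.
  have vY : Y ((Y^-1)%g u) != (Y^-1)%g u.
    by rewrite permKV; apply: contraNneq Yu => {1}->; rewrite permKV.
  by rewrite (inv X) ?permKV; apply: YXu; rewrite ?Vn.
rewrite (inv Y) //; case: (eqVneq (X ((X^-1)%g u)) ((X^-1)%g u)) => [e|Xt].
  by rewrite permKV in e; rewrite -e Yu {1}e permKV.
by rewrite XYu ?Vn // permKV.
Qed.

(** * Thin coset geometries of rank three *)

Section RankThree.
Variables (gT : finGroupType) (G : {group gT}) (H : 'I_3 -> {group gT}) (r : 'I_3 -> gT).
Local Open Scope group_scope.
Hypothesis genG : G = <<[set r i | i : 'I_3]>> :> {set gT}.
Hypothesis genH : forall i, H i = <<[set r (i + 1)%R; r (i + 2)%R]>> :> {set gT}.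
Hypothesis r_notin : forall i, r i \notin H i.
Hypothesis H_meet : forall i g, g \in H i -> g \in H (i + 1)%R -> g = 1 \/ g = r (i + 2)%R.
Hypothesis H_factor : forall i g2 g3, g2 \in H (i + 1)%R -> g3 \in H (i + 2)%R ->
  g2 * g3 \in H i ->
  exists f2 f3, [/\ f2 \in H i :&: H (i + 1)%R, f3 \in H i :&: H (i + 2)%R & g2 * g3 = f2 * f3].

Local Notation X := (coset_geometry card_I3_gt0 G H).

Lemma rG i : r i \in G. Proof. by rewrite genG mem_gen ?imset_f. Qed.

Lemma rH i j : i != j -> r j \in H i.
Proof.
rewrite genH; case: (ord3_cases i j) => ->; first by rewrite eqxx.
  by rewrite mem_gen ?set21.
by rewrite mem_gen ?set22.
Qed.

Lemma HG i : H i \subset G.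
Proof. by rewrite genH gen_subG; apply/subsetP => g /set2P[] ->; apply: rG. Qed.

Lemma H_meet_neq i j g : i != j -> g \in H i -> g \in H j ->
  exists l, [/\ l != i, l != j & g = 1 \/ g = r l].
Proof.
have [n1 n2 n3] := ord3_neq i; case: (ord3_cases i j) => ->; first by rewrite eqxx.
  by move=> _ gi gj; exists (i + 2)%R; split=> //; apply: H_meet.
move=> _ gi gj; exists (i + 1)%R; split=> //; first by rewrite eq_sym.
by have := H_meet gj; rewrite !ord3_add => /(_ gi).
Qed.

Lemma H_core g : (forall i, g \in H i) -> g = 1.
Proof.
move=> gH; case: (H_meet (gH 0%R) (gH _)) => // e.
by have := r_notin (0 + 2)%R; rewrite -e gH.
Qed.

(** * Elements, flags and chambers of the coset geometry *)

Lemma base_proof i : (i, H i : {set gT}).2 \in lcosets (H (i, H i : {set gT}).1) G.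
Proof. by apply/lcosetsP; exists 1; rewrite ?group1 ?lcoset1. Qed.

(** The coset [H i] serves as default value, so that [el] is total in [g]. *)
Definition el (g : gT) (i : 'I_3) : X :=
  insubd (Sub (i, H i : {set gT}) (base_proof i) : coset_elt G H) (i, g *: H i).

Lemma val_el g i : g \in G -> val (el g i : coset_elt G H) = (i, g *: H i).
Proof.
by move=> gG; rewrite val_insubd ifT //=; apply/lcosetsP; exists g.
Qed.

Lemma etype_el g i : g \in G -> etype (el g i) = i.
Proof. by move=> gG; rewrite /= /coset_etype val_el. Qed.

Lemma elP (x : X) : exists2 g, g \in G & x = el g (etype x).
Proof.
have /lcosetsP[g gG xE] := valP (x : coset_elt G H); exists g => //.
by apply: val_inj; rewrite val_el //= -xE /= /coset_etype -surjective_pairing.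
Qed.

Lemma el_eq g h i : g \in G -> h \in G -> (el g i = el h i) <-> (g^-1 * h \in H i).
Proof.
move=> gG hG; rewrite -mem_lcoset; split => [|/lcoset_eqP e].
  by move/(congr1 (fun x : X => (val (x : coset_elt G H)).2)); rewrite !val_el //= => ->; apply: lcoset_refl.
by apply: val_inj; rewrite !val_el // e.
Qed.

Lemma el_mul g h i : g \in G -> h \in H i -> el (g * h) i = el g i.
Proof.
move=> gG hH; have hG := subsetP (HG i) _ hH.
by apply/el_eq => //; [exact: groupM | rewrite invMg -mulgA mulVg mulg1 groupV].
Qed.

Lemma el_incident (x y : X) : etype x != etype y -> incident x y ->
  exists2 g, g \in G & x = el g (etype x) /\ y = el g (etype y).
Proof.
move=> hxy /orP[/eqP e|/andP[_ /set0Pn[g /setIP[gx gy]]]]; first by rewrite e eqxx in hxy.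
have [a aG xE] := elP x; have [b bG yE] := elP y.
move: gx gy; rewrite {1}xE {1}yE /coset_val !val_el //= => gx gy.
have gG : g \in G.
  case/lcosetP: gx => h hH ->; rewrite groupM //; exact: (subsetP (HG _) _ hH).
exists g => //; split; [rewrite {1}xE|rewrite {1}yE]; apply/el_eq; rewrite // -mem_lcoset //.
Qed.

Lemma incident_el g i j : g \in G -> incident (el g i) (el g j).
Proof.
move=> gG; case: (eqVneq i j) => [->|ij]; first exact: incident_refl.
rewrite /= /coset_incident /= /coset_etype !val_el //= ij /=.
apply/orP; right; apply/set0Pn; exists g; rewrite /coset_val !val_el //= inE !mem_lcoset.
by rewrite !mulVg !group1.
Qed.

Definition cham g : {set X} := [set el g i | i : 'I_3].

Lemma el_cham g i : el g i \in cham g. Proof. exact: imset_f. Qed.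

Lemma cham_flag g : g \in G -> flag (cham g).
Proof.
move=> gG; apply/forall_inP => _ /imsetP[i _ ->]; apply/forall_inP => _ /imsetP[j _ ->].
exact: incident_el.
Qed.

Lemma cham_chamber g : g \in G -> chamber (cham g).
Proof.
move=> gG; rewrite /chamber cham_flag //=; apply/eqP/setP => i; rewrite inE.
by apply/imsetP; exists (el g i); rewrite ?el_cham ?etype_el.
Qed.

Lemma flag_inc (F : {set X}) x y : flag F -> x \in F -> y \in F -> incident x y.
Proof. by move=> /forall_inP h xF yF; move/forall_inP: (h x xF); apply. Qed.

Lemma flag_uniq (F : {set X}) x y : flag F -> x \in F -> y \in F -> etype x = etype y -> x = y.
Proof.
move=> fF xF yF /eqP e; case: (eqVneq x y) => // xy.
by have := incident_type (flag_inc fF xF yF) xy; rewrite e.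
Qed.

(** Vacuous when [F] has no element of type [i], which lets complete and incomplete flags be handled
    alike. *)
Definition fits (F : {set X}) g i := forall x, x \in F -> etype x = i -> x = el g i.

Lemma fits1 F g x : flag F -> x \in F -> x = el g (etype x) -> fits F g (etype x).
Proof. by move=> fF xF xE y yF e; rewrite -xE; exact: (flag_uniq fF yF xF e). Qed.

Lemma fits_none (F : {set X}) g i : ~~ [exists x in F, etype x == i] -> fits F g i.
Proof.
by move=> h x xF e; case/negP: h; apply/existsP; exists x; rewrite xF e eqxx.
Qed.

Lemma fits_pair F i j : flag F -> i != j -> exists2 g, g \in G & fits F g i /\ fits F g j.
Proof.
move=> fF ij.
case: (boolP [exists x in F, etype x == i]) => [/existsP[x /andP[xF /eqP xi]]|ni];
case: (boolP [exists x in F, etype x == j]) => [/existsP[y /andP[yF /eqP yj]]|nj].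
- have [|g gG [xE yE]] := @el_incident x y _ (flag_inc fF xF yF); first by rewrite xi yj.
  by exists g => //; rewrite -xi -yj; split; apply: fits1.
- have [g gG xE] := elP x; exists g => //; split; last exact: fits_none.
  by rewrite -xi; apply: fits1.
- have [g gG yE] := elP y; exists g => //; split; first exact: fits_none.
  by rewrite -yj; apply: fits1.
- by exists 1; rewrite ?group1 //; split; apply: fits_none.
Qed.

(** The source of flag transitivity: every flag sits in a translate of the base chamber. Two types
    are matched by a common element of two incident cosets; a third one needs [H_factor]. *)
Lemma flag_cham F : flag F -> exists2 g, g \in G & F \subset cham g.
Proof.
move=> fF; suff [g gG hg] : exists2 g, g \in G & forall i, fits F g i.
  exists g => //; apply/subsetP => x xF; rewrite (hg _ _ xF erefl); exact: el_cham.
case: (boolP [forall i, exists x in F, etype x == i]) => [/forallP h|]; last first.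
  rewrite negb_forall => /existsP[i ni]; have [n1 n2 n3] := ord3_neq i.
  have [|g gG [g1 g2]] := @fits_pair F (i + 1)%R (i + 2)%R fF; first by rewrite eq_sym.
  by exists g => // j; case: (ord3_cases i j) => -> //; apply: fits_none.
pose i : 'I_3 := 0%R; have [n1 n2 n3] := ord3_neq i.
have [|w wG [w0 w1]] := @fits_pair F i (i + 1)%R fF; first by rewrite eq_sym.
have /existsP[x0 /andP[x0F /eqP x0i]] := h i.
have /existsP[x1 /andP[x1F /eqP x1i]] := h (i + 1)%R.
have /existsP[x2 /andP[x2F /eqP x2i]] := h (i + 2)%R.
have [|u uG [u0 u2]] := @el_incident x0 x2 _ (flag_inc fF x0F x2F).
  by rewrite x0i x2i eq_sym.
have [|v vG [v1 v2]] := @el_incident x1 x2 _ (flag_inc fF x1F x2F).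
  by rewrite x1i x2i eq_sym.
rewrite x0i in u0; rewrite x1i in v1; rewrite x2i in u2 v2.
move: u0; rewrite (w0 _ x0F x0i) => /el_eq - /(_ wG uG) wu.
move: v1; rewrite (w1 _ x1F x1i) => /el_eq - /(_ wG vG) wv.
(* The pairwise intersections put [w^-1 * v], [v^-1 * u] and their product [w^-1 * u] into the three
   parabolics, as [H_factor] requires. Moving [w] by [f2] keeps its cosets of types [i] and [i + 1],
   and the coset of type [i + 2] absorbs [f3]. *)
have uv : v^-1 * u \in H (i + 2)%R by apply/el_eq; rewrite // -u2 -v2.
have e : (w^-1 * v) * (v^-1 * u) = w^-1 * u by rewrite mulgA mulgK.
have [|f2 [f3 [/setIP[f20 f21] /setIP[_ f32] e']]] := @H_factor i _ _ wv uv; first by rewrite e.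
have f2G := subsetP (HG i) _ f20.
exists (w * f2) => [|j]; first by rewrite groupM.
case: (ord3_cases i j) => -> y yF yj.
- by rewrite el_mul // (w0 y).
- by rewrite el_mul // (w1 y).
- rewrite -(el_mul (h := f3)) ?groupM // -mulgA -e' e mulKVg -u2.
  by apply: (flag_uniq fF) => //; rewrite yj.
Qed.

Lemma chamberP C : chamber C -> exists2 g, g \in G & C = cham g.
Proof.
case/andP => fC /eqP tC; have [g gG sC] := flag_cham fC; exists g => //.
apply/eqP; rewrite eqEsubset sC; apply/subsetP => _ /imsetP[i _ ->].
have : i \in type_of C by rewrite tC inE.
case/imsetP => x xC xi; have /imsetP[j _ xE] := subsetP sC _ xC.
by move: xi; rewrite xE etype_el // => ->; rewrite -xE.
Qed.

Lemma cham_eq g h : g \in G -> h \in G -> cham g = cham h -> g = h.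
Proof.
move=> gG hG e; apply/eqP; rewrite eq_mulVg1; apply/eqP; apply: H_core => i.
apply/el_eq => //; apply: (flag_uniq (cham_flag hG)); rewrite ?etype_el ?el_cham //.
by rewrite -e el_cham.
Qed.

(** * Geometry, thinness and residual connectedness *)

Lemma coset_is_geometry : is_geometry X.
Proof.
move=> F /maxsetP[fF maxF]; have [g gG sF] := flag_cham fF.
by rewrite -(maxF _ (cham_flag gG) sF) cham_chamber.
Qed.

(** A chamber on the flag is [cham h] with [g^-1 * h] in both parabolics of type other than [i], and
    these meet in 1 and [r i]. *)
Lemma coset_thin : thin X.
Proof.
move=> i F fF tF; have [g gG sF] := flag_cham fF.
have elF j : j != i -> el g j \in F.
  move=> ji; have : j \in type_of F by rewrite tF !inE.
  case/imsetP => x xF xj; have /imsetP[l _ xE] := subsetP sF _ xF.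
  by move: xj; rewrite xE etype_el // => ->; rewrite -xE.
have grG : g * r i \in G by rewrite groupM ?rG.
have elr j : j != i -> el (g * r i) j = el g j by move=> ji; rewrite el_mul ?rH.
rewrite (_ : [set C | _] = [set cham g; cham (g * r i)]); last first.
  apply/setP => C; rewrite !inE; apply/andP/orP => [[cC FC]|[]/eqP->]; last first.
  - split; first exact: cham_chamber.
    apply/subsetP => x xF; have /imsetP[j _ xE] := subsetP sF _ xF.
    have ji : j != i.
      have : etype x \in type_of F by apply: imset_f.
      by rewrite tF !inE xE etype_el.
    by rewrite xE -elr ?el_cham.
  - by rewrite cham_chamber.
  have [h hG CE] := chamberP cC.
  have gh j : j != i -> g^-1 * h \in H j.
    move=> ji; apply/el_eq => //; apply: (flag_uniq (cham_flag hG)); rewrite ?etype_el ?el_cham //.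
    by rewrite -CE (subsetP FC) ?elF.
  have [n1 n2 n3] := ord3_neq i.
  have := H_meet (gh _ n1); rewrite !ord3_add => /(_ (gh _ n2)) [] e; [left|right]; rewrite CE.
    by rewrite -(mulKVg g h) e mulg1.
  by rewrite -e mulKVg.
rewrite cards2; case: eqP => // /cham_eq - /(_ gG grG) e.
have r1 : r i = 1 by apply: (mulgI g); rewrite mulg1 -e.
by have := r_notin i; rewrite r1 group1.
Qed.

(** Serves both the whole geometry and the residue of an element. A path follows a word for [h]:
    right multiplication by [r l] does not change a coset of type other than [l], and [J], having
    two elements, supplies such a type. *)
Lemma residue_connected (A : {set X}) (J : {set 'I_3}) w :
  w \in G ->
  1 < #|J| ->
  A = [set el (w * h) j | h in <<[set r j | j in J]>>, j in J] ->
  connected_on A.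
Proof.
move=> wG; case/card_gt1P => j1 [j2 [j1J j2J j12]] ->.
set K := <<_>>%g.
have KG : K \subset G.
  by rewrite gen_subG; apply/subsetP => _ /imsetP[j _ ->]; apply: rG.
have wK h : h \in K -> w * h \in G by move=> hK; rewrite groupM // (subsetP KG).
set A' := [set _ | _ in _, _ in _].
have elA h j : h \in K -> j \in J -> el (w * h) j \in A'.
  by move=> hK jJ; apply/imset2P; exists h j.
have adj h i j : h \in K -> i \in J -> j \in J ->
    connect (incidence_graph A') (el (w * h) i) (el (w * h) j).
  move=> hK iJ jJ; case: (eqVneq i j) => [->|ij]; first exact: connect0.
  apply: connect1; apply/and4P; split; [exact: elA|exact: elA| |apply: incident_el; exact: wK].
  by apply: contraNneq ij => /(congr1 (@etype _ X)); rewrite !etype_el ?wK // => ->.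
suff conn h j : h \in K -> j \in J -> connect (incidence_graph A') (el w j1) (el (w * h) j).
  have sym : connect_sym (incidence_graph A').
    apply: sym_connect_sym => x y; apply/and4P/and4P => -[? ? ? ?]; split=> //.
    1,3: by rewrite eq_sym.
    1,2: by rewrite incident_sym.
  move=> _ _ /imset2P[h j hK jJ ->] /imset2P[h' j' hK' jJ' ->].
  by apply: connect_trans (conn _ _ hK' jJ'); rewrite sym conn.
suff c1 : h \in K -> connect (incidence_graph A') (el w j1) (el (w * h) j1).
  by move=> hK jJ; apply: connect_trans (c1 hK) (adj _ _ _ hK j1J jJ).
case/gen_prodgP => n [c hc ->]; elim: n c hc => [|n IH] c hc.
  by rewrite big_ord0 mulg1 connect0.
rewrite big_ord_recr /=; set p := \prod_(_ < n) _.
have pK : p \in K by apply: group_prod => i _; rewrite mem_gen.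
have {}IH : connect (incidence_graph A') (el w j1) (el (w * p) j1) by apply: IH => i; apply: hc.
apply: connect_trans IH _; have /imsetP[l lJ ->] := hc ord_max.
have prK : p * r l \in K by rewrite groupM // mem_gen ?imset_f.
have [i iJ il] : exists2 i, i \in J & i != l.
  by case: (eqVneq j1 l) => [<-|h1]; [exists j2; rewrite // eq_sym | exists j1].
apply: connect_trans (adj _ _ _ pK j1J iJ) _.
have -> : el (w * p) i = el (w * (p * r l)) i by rewrite mulgA [RHS]el_mul ?wK ?rH //.
exact: adj.
Qed.

Lemma coset_residually_connected : residually_connected X.
Proof.
move=> F fF; rewrite /residue_rank card_ord => hF.
have [g gG sF] := flag_cham fF.
(* Rank at least 2 leaves only flags with at most one element. *)
case: (set_0Vmem F) => [F0|[x xF]].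
  have genT : <<[set r j | j in [set: 'I_3]]>> = G.
    by rewrite genG; congr (<<_>>); apply/setP => x; apply/imsetP/imsetP => -[j _ ->]; exists j.
  apply: (@residue_connected _ setT 1) => //; first by rewrite cardsT card_ord.
  apply/setP => x; rewrite !inE F0 inE /=; apply/idP/imset2P.
    by move=> _; have [h hG xE] := elP x; exists h (etype x); rewrite ?inE ?mul1g ?genT.
  by move=> _; apply/forall_inP => y; rewrite inE.
have [xg|] := boolP (F == [set x]); last first.
  move=> nF; exfalso; have : 1 < #|F|; last by lia.
  rewrite ltnNge; apply: contra nF => F1; rewrite eq_sym eqEcard sub1set xF cards1.
  exact: F1.
have /imsetP[i _ xE] := subsetP sF _ xF.
have HE : H i = <<[set r j | j in ~: [set i]]>> :> {set gT}.
  rewrite genH; congr (<<_>>); apply/setP => y; apply/set2P/imsetP.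
    have [n1 n2 n3] := ord3_neq i.
    by case=> ->; [exists (i + 1)%R | exists (i + 2)%R]; rewrite // !inE.
  case=> j; rewrite !inE; case: (ord3_cases i j) => -> //; auto.
  by rewrite eqxx.
apply: (@residue_connected _ (~: [set i]) g) => //.
  by rewrite cardsC1 card_ord.
rewrite -HE (eqP xg); apply/setP => y; rewrite !inE; apply/andP/imset2P.
  case=> yx /forall_inP /(_ x); rewrite inE eqxx => /(_ isT) yi.
  have tyx := incident_type yi yx.
  have [h hG [yE xE']] := el_incident tyx yi.
  have gx : etype x = i by rewrite xE etype_el.
  exists (g^-1 * h) (etype y); rewrite ?mulKVg // ?inE -?gx //.
  by rewrite gx; apply/el_eq => //; rewrite -xE {1}xE' gx.
case=> h j hH; rewrite !inE => ji ->.
have hG := subsetP (HG i) _ hH.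
have ghG : g * h \in G by rewrite groupM.
have xE' : x = el (g * h) i by rewrite el_mul.
split; last by apply/forall_inP => z; rewrite inE => /eqP ->; rewrite xE'; apply: incident_el.
rewrite xE'; apply: contraNneq ji => /(congr1 (@etype _ X)).
by rewrite !etype_el // => ->.
Qed.

(** * Correlations and words in the generators *)

Definition word (w : seq 'I_3) : gT := \prod_(i <- w) r i.

Lemma wordG w : word w \in G.
Proof. by rewrite /word big_seq; apply: group_prod => i _; apply: rG. Qed.

Lemma wordP g : g \in G -> exists w, g = word w.
Proof.
rewrite genG => /gen_prodgP[n [c hc ->]]; elim: n c hc => [|n IH] c hc.
  by exists [::]; rewrite /word big_nil big_ord0.
rewrite big_ord_recl; have /imsetP[i _ ->] := hc ord0.
have [j|w ->] := IH (fun j => c (lift ord0 j)); first exact: hc.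
by exists (i :: w); rewrite /word big_cons.
Qed.

Lemma corr_incident (phi : {perm X}) x y :
  correlation phi -> incident (phi x) (phi y) = incident x y.
Proof. by case/andP => /forallP /(_ x) /forallP /(_ y) /eqP. Qed.

Lemma corr_cham (phi : {perm X}) tau g : correlation phi -> correlation_type phi tau -> g \in G ->
  exists2 h, h \in G & forall i, phi (el g i) = el h (tau i).
Proof.
move=> cphi tphi gG.
have fF : flag (phi @: cham g).
  apply/forall_inP => _ /imsetP[_ /imsetP[i _ ->] ->].
  apply/forall_inP => _ /imsetP[_ /imsetP[j _ ->] ->].
  by rewrite corr_incident // incident_el.
have [h hG sF] := flag_cham fF; exists h => // i.
have /imsetP[j _ e] : phi (el g i) \in cham h.
  by apply: (subsetP sF); rewrite imset_f ?el_cham.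
by have := tphi (el g i); rewrite e !etype_el // => ->.
Qed.

(** [cham g] and [cham (g * r l)] differ only in type [l], so their images differ only in type
    [tau l]. As two parabolics share just one involution, the images are forced letter by letter,
    starting from the base chamber. *)
Lemma corr_word (phi : {perm X}) tau : correlation phi -> correlation_type phi tau ->
  (forall i, phi (el 1 i) = el 1 (tau i)) ->
  forall w i, phi (el (word w) i) = el (word (map tau w)) (tau i).
Proof.
move=> cphi tphi phi1; elim/last_ind => [|w l IH] i.
  by rewrite /word !big_nil.
have wE v m : word (rcons v m) = word v * r m by rewrite /word -cats1 big_cat big_seq1.
rewrite map_rcons !wE; set g := word w in IH *; set g' := word (map tau w) in IH *.
have gG : g \in G by apply: wordG.
have g'G : g' \in G by apply: wordG.
have glG : g * r l \in G by rewrite groupM ?rG.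
case: (eqVneq i l) => [->|il]; last first.
  by rewrite !el_mul ?rH // (inj_eq perm_inj).
have [h hG hE] := corr_cham cphi tphi glG.
have hj j : j != l -> g'^-1 * h \in H (tau j).
  by move=> jl; apply/el_eq => //; rewrite -hE el_mul ?rH.
have [n1 n2 n3] := ord3_neq l.
have [|m [m1 m2 e]] := H_meet_neq _ (hj _ n1) (hj _ n2).
  by rewrite (inj_eq perm_inj) eq_sym.
have ml : m = tau l.
  apply: (canRL (permKV tau)); case: (ord3_cases l ((tau^-1)%g m)) => // e'.
    by move: m1; rewrite -e' permKV eqxx.
  by move: m2; rewrite -e' permKV eqxx.
case: e => e; last by rewrite hE -ml -e mulKVg.
(* In this case [phi] would identify the elements of type [l] of two adjacent chambers, which
   [r_notin] separates. *)
have hg : h = g' by rewrite -(mulKVg g' h) e mulg1.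
have /perm_inj/el_eq : phi (el (g * r l) l) = phi (el g l) by rewrite hE hg IH.
move=> /(_ glG gG); rewrite invMg mulgKV groupV => rl.
by have := r_notin l; rewrite rl.
Qed.

(** * The automorphism group *)

Local Notation to := (coset_mul_action G H).

Lemma act_el a g i : a \in G -> g \in G -> to (el g i) a = el (a^-1 * g) i.
Proof.
move=> aG gG; apply: val_inj; rewrite [LHS]val_coset_mul // val_el ?groupM ?groupV //.
by rewrite /coset_etype /coset_val val_el //= lcosetM.
Qed.

Definition lmul (a : gT) : {perm X} := actperm to a.

Lemma lmul_el a g i : a \in G -> g \in G -> lmul a (el g i) = el (a^-1 * g) i.
Proof. by move=> aG gG; rewrite /lmul actpermE act_el. Qed.

Lemma lmulV a : a \in G -> lmul a^-1 = (lmul a)^-1.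
Proof. by move=> aG; apply: (morphV (actperm_morphism to)). Qed.

Lemma lmul_Aut a : a \in G -> lmul a \in Autg X.
Proof.
move=> aG; apply/AutgP; have ty b x : b \in G -> etype (lmul b x) = etype x.
  by move=> bG; have [g gG ->] := elP x; rewrite lmul_el // !etype_el // groupM ?groupV.
have inc b x y : b \in G -> incident x y -> incident (lmul b x) (lmul b y).
  move=> bG xy; case: (eqVneq (etype x) (etype y)) => e.
    have -> : x = y by apply/eqP; apply: contraT => /(incident_type xy); rewrite e eqxx.
    exact: incident_refl.
  have [g gG [-> ->]] := el_incident e xy.
  by rewrite !lmul_el //; apply: incident_el; rewrite groupM ?groupV.
split=> [x y|x]; last exact: ty.
apply/idP/idP; last exact: inc.
move/(inc _ _ _ (groupVr aG)); by rewrite lmulV // !permK.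
Qed.

Lemma Aut_correlation (phi : {perm X}) : phi \in Autg X -> correlation phi.
Proof. by rewrite inE => /andP[]. Qed.

Lemma Aut_type (phi : {perm X}) : phi \in Autg X -> correlation_type phi 1%g.
Proof. by case/AutgP => _ h x; rewrite h perm1. Qed.

(** A left multiplication brings the base chamber back; what remains fixes it and is trivial by
    [corr_word]. *)
Lemma Aut_lmul (phi : {perm X}) : phi \in Autg X -> exists2 a, a \in G & phi = lmul a.
Proof.
move=> aphi; have [h hG hE] := corr_cham (Aut_correlation aphi) (Aut_type aphi) (group1 G).
exists h^-1; rewrite ?groupV //.
pose psi := phi * lmul h.
have apsi : psi \in Autg X by rewrite groupM ?lmul_Aut.
have psi1 i : psi (el 1 i) = el 1 ((1 : {perm 'I_3}) i).
  by rewrite permM hE lmul_el // mulVg.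
suff p1 : psi = 1.
  by rewrite lmulV //; apply/eqP; rewrite eq_mulgV1 invgK -/psi p1.
apply/permP => x; rewrite perm1; have [g gG ->] := elP x; have [w ->] := wordP gG.
rewrite (corr_word (Aut_correlation apsi) (Aut_type apsi) psi1) perm1.
by rewrite (eq_map (g := id)) ?map_id // => i; rewrite perm1.
Qed.

Lemma coset_faithful : [faithful G, on [set: X] | to].
Proof.
apply/subsetP => a /setIP[aG ca]; apply/set1P; apply: H_core => i.
have := astab_act ca (in_setT (el 1 i)); rewrite act_el // mulg1 => /el_eq.
by rewrite groupV => /(_ aG (group1 _)); rewrite invgK mulg1.
Qed.

Lemma coset_Aut_isog : Autg X \isog G.
Proof.
have fa := coset_faithful.
have injf : 'injm (actperm_morphism to).
  rewrite ker_actperm; apply: subset_trans fa; rewrite subsetI subxx andbT.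
  by apply/subsetP => a; apply: astab_dom.
have -> : Autg X = actperm_morphism to @* G.
  apply/setP => phi; apply/idP/morphimP => [/Aut_lmul[a aG ->]|[a _ aG ->]]; first by exists a.
  exact: lmul_Aut.
by rewrite isog_sym; apply: sub_isog.
Qed.

Lemma coset_flag_transitive : flag_transitive X.
Proof.
apply/imsetP; exists (cham 1); first by rewrite inE cham_chamber.
apply/setP => C; rewrite inE; apply/idP/imsetP => [/chamberP[g gG ->]|[phi aphi ->]].
  exists (lmul g^-1); first by rewrite lmul_Aut ?groupV.
  rewrite /= /setact; apply/setP => x; apply/imsetP/imsetP => [[i _ ->]|[_ /imsetP[i _ ->] ->]].
    by exists (el 1 i); rewrite ?el_cham //= /aperm lmul_el ?groupV // invgK mulg1.
  by exists i; rewrite //= /aperm lmul_el ?groupV // invgK mulg1.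
have [a aG ->] := Aut_lmul aphi.
suff -> : ('P^*%act (cham 1) (lmul a)) = cham a^-1 by rewrite cham_chamber ?groupV.
rewrite /= /setact; apply/setP => x; apply/imsetP/imsetP => [[_ /imsetP[i _ ->] ->]|[i _ ->]].
  by exists i; rewrite //= /aperm lmul_el // mulg1.
by exists (el 1 i); rewrite ?el_cham //= /aperm lmul_el // mulg1.
Qed.

(** * Dualities and trialities *)

Lemma duality_words (phi : {perm X}) : duality phi ->
  exists i j, i != j /\ forall w, word w = 1 -> word (map (tperm i j) w) = 1.
Proof.
case=> cphi [i [j [ij tphi]]]; exists i, j; split=> // w w1.
have [h hG hE] := corr_cham cphi tphi (group1 G).
(* [psi] fixes the base chamber up to types, so [corr_word] applies; the image of a relation then
   lies in every parabolic, hence is 1 by [H_core]. *)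
pose psi := phi * lmul h.
have cpsi : correlation psi.
  have /AutgP[inc ty] := lmul_Aut hG.
  case/andP: cphi => /forallP cphi1 /forallP cphi2; apply/andP; split; apply/forallP => x.
    by apply/forallP => y; rewrite !permM inc (eqP (forallP (cphi1 x) y)).
  by apply/forallP => y; rewrite !permM !ty (forallP (cphi2 x) y).
have tpsi : correlation_type psi (tperm i j).
  by move=> x; have /AutgP[_ ty] := lmul_Aut hG; rewrite permM ty tphi.
have psi1 l : psi (el 1 l) = el 1 (tperm i j l).
  by rewrite permM hE lmul_el // mulVg.
apply: H_core => l; have := corr_word cpsi tpsi psi1 w (tperm i j l).
rewrite w1 psi1 tpermK => /el_eq; rewrite invg1 mul1g; apply; rewrite ?group1 //.
exact: wordG.
Qed.

(** [t] may lie outside [G]: conjugation by it preserves [G] and cycles the parabolics, so it maps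
    cosets of [H i] to cosets of [H (i + 1)]. *)
Lemma conj_triality t : (forall i, r i ^ t = r (i + 1)%R) -> exists phi : {perm X}, triality phi.
Proof.
move=> rt.
have Ht i : H i :^ t = H (i + 1)%R.
  by rewrite !genH -genJ conjUg !conjg_set1 !rt; congr (<<_ :|: _>>); rewrite !ord3_add.
have Gt g : g \in G -> g ^ t \in G.
  move=> /wordP[w ->]; rewrite /word; elim: w => [|i w IH]; first by rewrite big_nil conj1g.
  by rewrite big_cons conjMg groupM // rt rG.
pose f (x : X) : X := el (repr (coset_val (x : coset_elt G H)) ^ t) (etype x + 1)%R.
have fE g i : g \in G -> f (el g i) = el (g ^ t) (i + 1)%R.
  move=> gG; rewrite /f etype_el // /coset_val val_el //=.
  have /lcosetP[h hH ->] : repr (g *: H i) \in g *: H i by apply: (mem_repr g); apply: lcoset_refl.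
  by rewrite conjMg el_mul ?Gt // -Ht memJ_conjg.
have injf : injective f.
  move=> x y; have [g gG ->] := elP x; have [h hG ->] := elP y; rewrite !fE // => e.
  have := congr1 (@etype _ X) e; rewrite !etype_el ?Gt // => /addIr e'.
  move: e; rewrite -e' => /el_eq - /(_ (Gt _ gG) (Gt _ hG)).
  by rewrite -conjVg -conjMg -Ht memJ_conjg => /el_eq ->.
have tf x : etype (f x) = (etype x + 1)%R by have [g gG ->] := elP x; rewrite fE // !etype_el ?Gt.
have incf x y : incident x y -> incident (f x) (f y).
  move=> xy; case: (eqVneq (etype x) (etype y)) => e.
    have -> : x = y by apply/eqP; apply: contraT => /(incident_type xy); rewrite e eqxx.
    exact: incident_refl.
  have [g gG [-> ->]] := el_incident e xy.
  by rewrite !fE //; apply: incident_el; rewrite Gt.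
pose phi := perm injf; exists phi.
(* The inverse of [phi] is one of its powers, so that incidence is also reflected. *)
have incX n x y : incident x y -> incident ((phi ^+ n) x) ((phi ^+ n) y).
  elim: n => [|n IH] xy; first by rewrite !perm1.
  by rewrite expgSr !permM !permE; apply: incf; apply: IH.
have tauI : injective (fun i : 'I_3 => (i + 1)%R) by move=> i j /addIr.
split.
  apply/andP; split; apply/forallP => x; apply/forallP => y; last first.
    by apply/implyP => /eqP e; rewrite !permE !tf e.
  apply/eqP; apply/idP/idP => h; last by rewrite !permE incf.
  have := incX #[phi].-1 _ _ h; rewrite -!permM -expgS prednK ?order_gt0 // expg_order.
  by rewrite !perm1.
exists (perm tauI), 0%R, 1%R, 2%R; split; last by move=> x; rewrite !permE tf.
split=> //; rewrite ?permE; try exact: val_inj.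
by move=> l; rewrite !inE; case: (ord3_cases 0%R l) => ->; rewrite ?add0r eqxx ?orbT.
Qed.

End RankThree.

(** * Images of words under a permutation of the generators *)

Section Corresp.
Variables (gT : finGroupType) (r : 'I_3 -> gT) (tau : {perm 'I_3}).
Local Open Scope group_scope.
Hypothesis r2 : forall i, r i * r i = 1.

(* g' is a value of g after applying tau to the letters of a word for g. *)
Definition corresp (g g' : gT) := exists w, word r w = g /\ word r (map tau w) = g'.

Lemma corresp_gen i : corresp (r i) (r (tau i)).
Proof. by exists [:: i]; rewrite /word !big_seq1. Qed.

Lemma corresp1 : corresp 1 1.
Proof. by exists [::]; rewrite /word !big_nil. Qed.

Lemma correspM g g' h h' : corresp g g' -> corresp h h' -> corresp (g * h) (g' * h').
Proof.
by move=> [v [<- <-]] [w [<- <-]]; exists (v ++ w); rewrite /word map_cat !big_cat.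
Qed.

Lemma word_rev w : word r (rev w) = (word r w)^-1.
Proof.
elim: w => [|i w IH]; first by rewrite /word big_nil invg1.
rewrite rev_cons -cats1 /word big_cat big_seq1 big_cons invMg; congr (_ * _); first exact: IH.
by rewrite invol_inv.
Qed.

Lemma correspV g g' : corresp g g' -> corresp g^-1 g'^-1.
Proof. by move=> [w [<- <-]]; exists (rev w); rewrite map_rev !word_rev. Qed.

Lemma correspX n g g' : corresp g g' -> corresp (g ^+ n) (g' ^+ n).
Proof.
by move=> h; elim: n => [|n IH]; [exact: corresp1 | rewrite !expgS; apply: correspM].
Qed.

Lemma correspJ g g' h h' : corresp g g' -> corresp h h' -> corresp (g ^ h) (g' ^ h').
Proof. by move=> hg hh; rewrite !conjgE; do !apply: correspM => //; apply: correspV. Qed.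

Lemma correspR g g' h h' : corresp g g' -> corresp h h' -> corresp [~ g, h] [~ g', h'].
Proof. by move=> hg hh; rewrite !commgEl; apply: correspM (correspV hg) (correspJ hg hh). Qed.

End Corresp.

(** * A relation between two 3-cycles with two common points *)

Section FourPoints.
Variables (T : finType) (o q p1 p2 : T).
Hypotheses (oq : o != q) (op1 : o != p1) (op2 : o != p2) (qp1 : q != p1) (qp2 : q != p2)
  (p12 : p1 != p2).

(** [M] is the double transposition (o p2)(q p1). *)
Lemma cycle3_double_swap :
  let M := (cycle3 o q p1 * cycle3 q p2 o)%g in (M ^+ 2 = 1)%g.
Proof.
move=> M.
have Mo : M o = p2 by rewrite permM cycle3_1 ?cycle3_1; try sneq.
have Mq : M q = p1 by rewrite permM cycle3_2 cycle3_id; try sneq.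
have Mp1 : M p1 = q by rewrite permM cycle3_3 ?cycle3_3; try sneq.
have Mp2 : M p2 = o by rewrite permM (@cycle3_id T o q p1 p2) ?cycle3_2; try sneq.
apply/permP => u; rewrite expgS expg1 permM perm1.
case: (eqVneq u o) => [->|uo]; first by rewrite Mo Mp2.
case: (eqVneq u q) => [->|uq]; first by rewrite Mq Mp1.
case: (eqVneq u p1) => [->|u1]; first by rewrite Mp1 Mq.
case: (eqVneq u p2) => [->|u2]; first by rewrite Mp2 Mo.
have -> : M u = u by rewrite permM !cycle3_id.
by rewrite permM !cycle3_id.
Qed.

End FourPoints.

(** * The permutation graph in coordinates *)

Section Family.

Variable k : nat.

Definition swap a b x : nat := if x == a then b else if x == b then a else x.

Lemma letter_inj x y : 0 < x <= deg k -> 0 < y <= deg k ->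
  letter k x = letter k y -> x = y.
Proof.
rewrite /deg => hx hy /(congr1 val); rewrite /letter /= !inordK; lia.
Qed.

Lemma transpE a b x : 0 < a <= deg k -> 0 < b <= deg k -> 0 < x <= deg k ->
  transp k a b (letter k x) = letter k (swap a b x).
Proof.
move=> ha hb hx; rewrite /transp /swap.
case: eqP => [->|xa]; first by rewrite tpermL.
case: eqP => [->|xb]; first by rewrite tpermR.
by rewrite tpermD //; apply/eqP => /letter_inj e; [apply: xa|apply: xb]; rewrite e.
Qed.

(** The product of the disjoint transpositions (a + 6i, a + 3 + 6i), i < n, in closed form. *)
Definition block a n x : nat :=
  if a <= x < a + 6 * n then
    if (x - a) %% 6 == 0 then x + 3 else if (x - a) %% 6 == 3 then x - 3 else x
  else x.

(** For positive [n], the bound says that the largest letter moved, a + 6n - 3, is at most the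
    degree. *)
Lemma blockE a n x : 0 < a -> a + 6 * n <= deg k + 3 -> 0 < x <= deg k ->
  (\prod_(i < n) transp k (a + 6 * i) (a + 3 + 6 * i))%g (letter k x)
  = letter k (block a n x).
Proof.
move=> a0; rewrite /deg; elim: n => [|n IH] hn hx.
  by rewrite big_ord0 perm1 /block; case: ifP => //; lia.
rewrite big_ord_recr /= permM IH //; last by lia.
rewrite transpE; [|rewrite /deg; lia|rewrite /deg; lia|by rewrite /block /deg; do ?case: ifP; lia].
by congr letter; rewrite /block /swap; do !case: ifP; lia.
Qed.

Definition rho (s : 'I_3) : 'S_(deg k) := nth 1%g [:: rho1 k; rho2 k; rho3 k] s.

Definition sw1 x :=
  swap (10 + 6 * k) (16 + 6 * k) (swap (9 + 6 * k) (12 + 6 * k)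
    (block 5 k.+1 (block 4 k.+1 (swap 1 2 x)))).
Definition sw2 x :=
  swap (10 + 6 * k) (13 + 6 * k) (swap (8 + 6 * k) (14 + 6 * k)
    (block 6 k.+1 (block 2 k.+1 (swap 1 3 x)))).
Definition sw3 x :=
  swap (9 + 6 * k) (15 + 6 * k) (swap (8 + 6 * k) (11 + 6 * k)
    (block 7 k.+1 (block 3 k.+1 (swap 1 4 x)))).

Lemma swap_bound a b x : 0 < a <= deg k -> 0 < b <= deg k ->
  0 < x <= deg k -> 0 < swap a b x <= deg k.
Proof. by rewrite /swap; case: ifP => // _; case: ifP. Qed.

Lemma block_bound a n x : a + 6 * n <= deg k + 3 -> 0 < a ->
  0 < x <= deg k -> 0 < block a n x <= deg k.
Proof. by rewrite /block /deg => ? ? ?; do !case: ifP; lia. Qed.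

Lemma rhoE (s : 'I_3) x : 0 < x <= deg k ->
  rho s (letter k x) = letter k (nth id [:: sw1; sw2; sw3] s x).
Proof.
case: s => [[|[|[|//]]]] ? hx; rewrite /rho /= /rho1 /rho2 /rho3 !permM.
all: rewrite transpE; first rewrite blockE; first rewrite blockE; first rewrite !transpE //.
all: repeat first [apply: swap_bound | apply: block_bound] => //.
all: by move: hx; rewrite /deg; lia.
Qed.

(* The centre of the tripod, and the j-th point of the arm that starts with the
   edge of rho s; j = 2k + 2 is the end of the path, and j = 2k + 3, 2k + 4 are
   the two leaves of the fork. *)
Definition ctr := letter k 1.
Definition pt (s : 'I_3) j := letter k (2 + s + 3 * j).

(* The action of rho (t + d) on the arm t; None stands for the centre. *)
Definition step (d : 'I_3) j : option nat :=
  match val d with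
  | 0 => if j == 0 then None else
         if j <= 2 * k + 2 then Some (if odd j then j.+1 else j.-1) else Some j
  | 1 => if j <= 2 * k + 1 then Some (if odd j then j.-1 else j.+1) else
         if j == 2 * k + 2 then Some (2 * k + 4) else
         if j == 2 * k + 4 then Some (2 * k + 2) else Some j
  | _ => if j == 2 * k + 2 then Some (2 * k + 3) else
         if j == 2 * k + 3 then Some (2 * k + 2) else Some j
  end.

Definition opt_pt (t : 'I_3) (o : option nat) := if o is Some j then pt t j else ctr.

Lemma letter_eq x y : x = y -> letter k x = letter k y.
Proof. by move->. Qed.

Lemma rho_ctr s : rho s ctr = pt s 0.
Proof.
rewrite rhoE //; apply: letter_eq.
case: s => [[|[|[|//]]]] ? /=.
all: rewrite /sw1 /sw2 /sw3 /swap /block; split_ifs; lia.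
Qed.

Lemma rho_pt (s t : 'I_3) j : j <= 2 * k + 4 ->
  rho s (pt t j) = opt_pt t (step (s - t)%R j).
Proof.
move=> hj; rewrite rhoE; last first.
  by have := ltn_ord t; rewrite /deg; lia.
rewrite /opt_pt /step /ctr /pt.
case: s t => [[|[|[|//]]]] ? [[|[|[|//]]]] ? /=.
all: split_ifs; apply: letter_eq.
all: rewrite /sw1 /sw2 /sw3 /swap /block; split_ifs; lia.
Qed.

Lemma step_sub (s : 'I_3) j :
  ((step (s - s)%R j = step 0%R j) * (step (s + 1 - s)%R j = step 1%R j)
  * (step (s + 2 - s)%R j = step 2%R j)
  * (step (s - (s + 1))%R j = step 2%R j)
  * (step (s + 1 - (s + 1))%R j = step 0%R j)
  * (step (s + 2 - (s + 1))%R j = step 1%R j)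
  * (step (s - (s + 2))%R j = step 1%R j)
  * (step (s + 1 - (s + 2))%R j = step 2%R j)
  * (step (s + 2 - (s + 2))%R j = step 0%R j))%type.
Proof.
by case: s => [[|[|[|//]]]] ?; do !split; congr (step _ _); apply: val_inj.
Qed.

Lemma step0 j : step 0%R j = if j == 0 then None else
  if j <= 2 * k + 2 then Some (if odd j then j.+1 else j.-1) else Some j.
Proof. by []. Qed.

Lemma step1 j : step 1%R j =
  if j <= 2 * k + 1 then Some (if odd j then j.-1 else j.+1) else
  if j == 2 * k + 2 then Some (2 * k + 4) else
  if j == 2 * k + 4 then Some (2 * k + 2) else Some j.
Proof. by []. Qed.

Lemma step2 j : step 2%R j =
  if j == 2 * k + 2 then Some (2 * k + 3) else
  if j == 2 * k + 3 then Some (2 * k + 2) else Some j.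
Proof. by []. Qed.

Lemma pt_inj s t i j : i <= 2 * k + 4 -> j <= 2 * k + 4 ->
  pt s i = pt t j -> s = t /\ i = j.
Proof.
have := ltn_ord s; have := ltn_ord t => ht hs hi hj /letter_inj.
rewrite /deg => e; have {}e : 2 + s + 3 * i = 2 + t + 3 * j by apply: e; lia.
by split; [apply: val_inj => /= | ]; lia.
Qed.

Lemma pt_neq_ctr s j : j <= 2 * k + 4 -> pt s j <> ctr.
Proof. by have := ltn_ord s => hs hj /letter_inj; rewrite /deg => e; lia. Qed.

Lemma pointP x : x = ctr \/ exists s j, j <= 2 * k + 4 /\ x = pt s j.
Proof.
have hx : x < 16 + 6 * k := ltn_ord x; case: (posnP x) => [x0|x0].
  left; apply: val_inj; rewrite /= /letter inordK //; lia.
(* The ordinal [x] stands for the letter x + 1 = 2 + s + 3j, so [s] and [j] are read off from x -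
   1. *)
right; exists (inord ((x.-1) %% 3)), ((x.-1) %/ 3).
have x3 : (x.-1) %% 3 < 3 by rewrite ltn_mod.
split; first by lia.
apply: val_inj; rewrite /= /letter !inordK //; lia.
Qed.

Lemma rho_invol s : (rho s * rho s = 1)%g.
Proof.
apply/permP => x; rewrite permM perm1.
case: (pointP x) => [->|[t [j [hj ->]]]].
  by rewrite rho_ctr rho_pt // step_sub step0.
rewrite rho_pt // /opt_pt; case: (ord3_cases t s) => ->; rewrite step_sub ?step0 ?step1 ?step2;
  split_ifs; rewrite ?rho_ctr ?rho_pt ?step_sub ?step0 ?step1 ?step2; try lia;
  rewrite /opt_pt; split_ifs; try congr (pt _ _); lia.
Qed.

(** * The long path of two consecutive generators *)

(** The number of points on the long path: the centre, the first point of arm [s + 1], and all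
    points of arm [s] but the leaf [2 * k + 3]. *)
Definition per : nat := 2 * k + 6.

(* Numbering the long path of rho s and rho (s + 1) first along its even and
   then back along its odd positions turns the path into a cycle of length per,
   on which both generators act as reflections. The origin of chart is the
   centre of the tripod. *)
Definition chart_nat (s : 'I_3) (p : nat) :=
  if p == 0 then pt (s + 1)%R 0 else
  if p <= k + 2 then pt s (2 * p - 2) else
  if p == k + 3 then pt s (2 * k + 4) else
  if p == 2 * k + 5 then ctr else pt s (2 * (per - p) - 3).

Definition chart (s : 'I_3) (r : int) := chart_nat s `|((r - 1) %% per%:Z)%Z|.

Lemma chartE s (q : int) p : p < per -> chart s (q * per%:Z + p%:Z + 1)%R = chart_nat s p.
Proof.
by move=> hp; rewrite /chart addrK modzMDl modz_small //; lia.
Qed.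

Lemma chart_decomp (r : int) :
  exists (q : int) (p : nat), p < per /\ r = (q * per%:Z + p%:Z + 1)%R.
Proof.
exists ((r - 1) %/ per%:Z)%Z, `|((r - 1) %% per%:Z)%Z|.
have per0 : (per%:Z != 0)%R by rewrite /per; lia.
have h0 := modz_ge0 (r - 1) per0; have h1 := ltz_mod (r - 1) per0.
by split; [lia | have := divz_eq (r - 1) per%:Z; lia].
Qed.

Lemma chart_per s (r r' : int) : (per%:Z %| (r - r')%R)%Z -> chart s r = chart s r'.
Proof.
move=> h; congr (chart_nat _ `|_|); apply/eqP; rewrite eqz_mod_dvd.
by rewrite opprB addrA subrK.
Qed.

Lemma chart_nat_inj s p p' : p < per -> p' < per -> chart_nat s p = chart_nat s p' -> p = p'.
Proof.
have [n1 n2 n3] := ord3_neq s.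
rewrite /chart_nat /per => hp hp'; split_ifs; move=> h; try lia.
all: try by move/esym/pt_neq_ctr: h; lia.
all: try by move/pt_neq_ctr: h; lia.
all: case/pt_inj: h; try lia.
all: by move=> eqs; try (move/eqP: eqs; rewrite ?(negPf n1) // eq_sym (negPf n1)).
Qed.

Lemma chart_inj s (r r' : int) : chart s r = chart s r' -> (per%:Z %| (r - r')%R)%Z.
Proof.
case: (chart_decomp r) => q [p [hp ->]]; case: (chart_decomp r') => q' [p' [hp' ->]].
rewrite !chartE // => /(chart_nat_inj hp hp') ->.
by apply/dvdzP; exists (q - q')%R; ring.
Qed.

Lemma rho_chart_nat s p : p < per -> rho s (chart_nat s p) = chart_nat s (if p == 0 then 0 else per - p).
Proof.
rewrite /chart_nat /per => hp; split_ifs; rewrite ?rho_ctr ?rho_pt ?step_sub ?step0 ?step1 ?step2; try lia.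
all: rewrite /opt_pt; split_ifs; first [by [] | congr (pt _ _); lia | lia].
Qed.

Lemma rho1_chart_nat s p : p < per -> rho (s + 1)%R (chart_nat s p) = chart_nat s (per - 1 - p).
Proof.
rewrite /chart_nat /per => hp; split_ifs; rewrite ?rho_ctr ?rho_pt ?step_sub ?step0 ?step1 ?step2; try lia.
all: rewrite /opt_pt; split_ifs; first [by [] | congr (pt _ _); lia | lia].
Qed.

Lemma rho_chart s r : rho s (chart s r) = chart s (2 - r)%R.
Proof.
case: (chart_decomp r) => q [p [hp ->]]; rewrite chartE // rho_chart_nat //.
(* Position 0 is fixed, while [per - 0] would leave the range of positions. *)
case: eqP => [->|p0]; last first.
  rewrite -(chartE s (- q - 1)%R); last lia.
  by apply: chart_per; apply/dvdzP; exists 0%R; lia.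
by rewrite -(chartE s (- q)%R); [congr (chart _ _); lia | rewrite /per; lia].
Qed.

Lemma rho1_chart s r : rho (s + 1)%R (chart s r) = chart s (1 - r)%R.
Proof.
case: (chart_decomp r) => q [p [hp ->]]; rewrite chartE // rho1_chart_nat //.
rewrite -(chartE s (- q - 1)%R); last lia.
by congr (chart _ _); lia.
Qed.

Lemma chart0 s : chart s 0%R = ctr.
Proof.
have -> : (0 = (- 1) * per%:Z + (2 * k + 5)%N%:Z + 1)%R by rewrite /per; lia.
rewrite chartE; last by rewrite /per; lia.
by rewrite /chart_nat /per; split_ifs; first [by [] | lia].
Qed.

Lemma chart1 s : chart s 1%R = pt (s + 1)%R 0.
Proof.
have -> : (1 = 0 * per%:Z + 0%N%:Z + 1)%R by rewrite /per; lia.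
rewrite chartE; last by rewrite /per; lia.
by rewrite /chart_nat /per; split_ifs; first [by [] | lia].
Qed.

Lemma chart2 s : chart s 2%R = pt s 0.
Proof.
have -> : (2 = 0 * per%:Z + 1%N%:Z + 1)%R by rewrite /per; lia.
rewrite chartE; last by rewrite /per; lia.
by rewrite /chart_nat /per; split_ifs; first [by [] | lia].
Qed.

(** The excluded coordinates are those of the centre, of the first point of arm [s + 1] and of the
    fork vertex [pt s (2 * k + 2)], where edges of the third generator leave the long path. *)
Lemma rho2_chart s (r : int) :
  ~~ (per%:Z %| r)%Z -> ~~ (per%:Z %| (r - 1)%R)%Z -> ~~ (per%:Z %| (r - (k%:Z + 3))%R)%Z ->
  rho (s + 2)%R (chart s r) = chart s r.
Proof.
case: (chart_decomp r) => q [p [hp ->]] h0 h1 h2; rewrite chartE //.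
have p0 : p != 0.
  by apply: contraNN h1 => /eqP ->; apply/dvdzP; exists q; ring.
have p1 : p != 2 * k + 5.
  by apply: contraNN h0 => /eqP ->; apply/dvdzP; exists (q + 1)%R; rewrite /per; lia.
have p2 : p != k + 2.
  by apply: contraNN h2 => /eqP ->; apply/dvdzP; exists q; rewrite /per; lia.
rewrite /chart_nat; split_ifs; rewrite ?rho_ctr ?rho_pt ?step_sub ?step0 ?step1 ?step2; try lia.
all: rewrite /opt_pt; move: hp; rewrite /per => hp; split_ifs; first [by [] | congr (pt _ _); lia | lia].
Qed.

Ltac act := rewrite ?rho_ctr ?rho_pt ?step_sub ?step0 ?step1 ?step2 /opt_pt; try lia;
  split_ifs; try lia.

Definition charted (s : 'I_3) (x : 'I_(deg k)) : Prop := exists r : int, x = chart s r.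

Definition rot (s : 'I_3) : 'S_(deg k) := (rho (s + 1)%R * rho s)%g.

Lemma rot_chart s r : rot s (chart s r) = chart s (r + 1)%R.
Proof. by rewrite permM rho1_chart rho_chart; congr (chart _ _); ring. Qed.

Lemma rotX_chart s n (r : int) : (rot s ^+ n)%g (chart s r) = chart s (r + n%:Z)%R.
Proof.
elim: n => [|n IH]; first by rewrite perm1 addr0.
by rewrite expgSr permM IH rot_chart; congr (chart _ _); lia.
Qed.

Lemma charted_ctr s : charted s ctr.
Proof. by exists 0%R; rewrite chart0. Qed.

Lemma charted_next s : charted s (pt (s + 1)%R 0).
Proof. by exists 1%R; rewrite chart1. Qed.

Lemma charted_arm s j : j <= 2 * k + 4 -> j != 2 * k + 3 -> charted s (pt s j).
Proof.
move=> hj hj3; case: (boolP (odd j)) => oj.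
  exists (0 * per%:Z + (per - (j + 3)./2)%N%:Z + 1)%R.
  rewrite chartE /chart_nat /per; last by lia.
  split_ifs; first [congr (pt _ _); lia | lia].
exists (0 * per%:Z + (j./2 + 1)%N%:Z + 1)%R.
rewrite chartE /chart_nat /per; last by lia.
split_ifs; first [congr (pt _ _); lia | lia].
Qed.

Variant uncharted (s : 'I_3) : 'I_(deg k) -> Prop :=
| UnchartedLeaf : uncharted s (pt s (2 * k + 3))
| UnchartedNext j of 0 < j <= 2 * k + 4 : uncharted s (pt (s + 1)%R j)
| UnchartedPrev j of j <= 2 * k + 4 : uncharted s (pt (s + 2)%R j).

Lemma chartP s x : charted s x \/ uncharted s x.
Proof.
case: (pointP x) => [->|[t [j [hj ->]]]]; first by left; apply: charted_ctr.
case: (ord3_cases s t) => ->.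
- case: (eqVneq j (2 * k + 3)) => [->|hj3]; first by right; constructor.
  by left; apply: charted_arm.
- case: (posnP j) => [->|j0]; first by left; apply: charted_next.
  by right; apply: UnchartedNext; rewrite j0.
- by right; apply: UnchartedPrev.
Qed.

Lemma chart_nat_cases s p : p < per -> [\/ chart_nat s p = ctr, chart_nat s p = pt (s + 1)%R 0 |
  exists j, [/\ j <= 2 * k + 4, j != 2 * k + 3 & chart_nat s p = pt s j]].
Proof.
rewrite /chart_nat /per => hp; split_ifs; first [by constructor 1 | by constructor 2 | idtac].
all: by constructor 3; eexists; split; last reflexivity; lia.
Qed.

Lemma chart_cases s r : [\/ chart s r = ctr, chart s r = pt (s + 1)%R 0 |
  exists j, [/\ j <= 2 * k + 4, j != 2 * k + 3 & chart s r = pt s j]].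
Proof.
by case: (chart_decomp r) => q [p [hp ->]]; rewrite chartE //; apply: chart_nat_cases.
Qed.

Lemma unchartedP s x : charted s x -> uncharted s x -> False.
Proof.
have [n1 n2 n3] := ord3_neq s.
case=> r ->; case: (chart_cases s r) => [->|->|[j [hj hj3 ->]]].
- by move=> h; inversion h as [e|i hi e|i hi e]; move/pt_neq_ctr: e; lia.
- by move=> h; inversion h as [e|i hi e|i hi e]; case/pt_inj: e; try lia;
    move=> e; first [by rewrite e eqxx in n1 | by rewrite -e eqxx in n1 | by rewrite e eqxx in n3].
- by move=> h; inversion h as [e|i hi e|i hi e]; case/pt_inj: e; try lia;
    move=> e; first [by rewrite e eqxx in n1 | by rewrite e eqxx in n2].
Qed.

(** * Orbits off the long path *)

Lemma rot_cycle2_prev s j : j <= 2 * k -> let x := pt (s + 2)%R j in (rot s ^+ 2)%g x = x.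
Proof.
move=> hj /=; rewrite expgS expg1 !permM; act; act; act; act; congr (pt _ _); lia.
Qed.

Lemma rot_cycle2_next s j : 0 < j <= 2 * k -> (rot s ^+ 2)%g (pt (s + 1)%R j) = pt (s + 1)%R j.
Proof.
move=> hj /=; rewrite expgS expg1 !permM; act; act; act; act; congr (pt _ _); lia.
Qed.

Lemma rot_cycle2_prev_end s : (rot s ^+ 2)%g (pt (s + 2)%R (2 * k + 1)) = pt (s + 2)%R (2 * k + 1).
Proof.
rewrite expgS expg1 !permM; act; act; act; act; congr (pt _ _); lia.
Qed.

Lemma rot_leaf s :
  [/\ rot s (pt (s + 2)%R (2 * k + 4)) = pt (s + 2)%R (2 * k + 2),
      rot s (pt (s + 2)%R (2 * k + 2)) = pt (s + 2)%R (2 * k + 3)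
    & rot s (pt (s + 2)%R (2 * k + 3)) = pt (s + 2)%R (2 * k + 4)].
Proof. by split; rewrite permM; act; act. Qed.

Lemma rot_end s :
  [/\ rot s (pt (s + 1)%R (2 * k + 1)) = pt (s + 1)%R (2 * k + 3),
      rot s (pt (s + 1)%R (2 * k + 3)) = pt (s + 1)%R (2 * k + 2)
    & rot s (pt (s + 1)%R (2 * k + 2)) = pt (s + 1)%R (2 * k + 1)].
Proof. by split; rewrite permM; act; act; congr (pt _ _); lia. Qed.

Lemma rot_fix s : rot s (pt (s + 1)%R (2 * k + 4)) = pt (s + 1)%R (2 * k + 4)
  /\ rot s (pt s (2 * k + 3)) = pt s (2 * k + 3).
Proof. by split; rewrite permM; act; act. Qed.

Lemma expg_fix_dvd (g : 'S_(deg k)) m n x : (g ^+ m)%g x = x -> m %| n -> (g ^+ n)%g x = x.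
Proof.
move=> gx /dvdnP[q ->]; rewrite mulnC expgM; elim: q => [|q IH]; first by rewrite perm1.
by rewrite expgS permM gx.
Qed.

(** Off the long path the orbits of [rot s] have length 1, 2 or 3; those of length 3 lie at the
    forks of the other two arms. *)
Lemma rotX6 s n x : 6 %| n -> uncharted s x -> (rot s ^+ n)%g x = x.
Proof.
move=> n6; have n2 : 2 %| n by apply: dvdn_trans n6.
have n3 : 3 %| n by apply: dvdn_trans n6.
case=> [|j hj|j hj].
- by apply: (@expg_fix_dvd _ 1) => //; case: (rot_fix s).
- case: (leqP j (2 * k)) => hj2.
    by apply: (@expg_fix_dvd _ 2) => //; apply: rot_cycle2_next; lia.
  have [e1 e2 e3] := rot_end s; have [e4 _] := rot_fix s.
  have hj4 : j = 2 * k + 1 \/ j = 2 * k + 2 \/ j = 2 * k + 3 \/ j = 2 * k + 4 by lia.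
  case: hj4 => [->|[->|[->|->]]]; last by apply: (@expg_fix_dvd _ 1); rewrite ?expg1.
  1-3: by apply: (@expg_fix_dvd _ 3) => //; rewrite 2!expgS expg1 2!permM !(e1, e2, e3).
- case: (leqP j (2 * k + 1)) => hj2.
    apply: (@expg_fix_dvd _ 2) => //; case: (eqVneq j (2 * k + 1)) => [->|?].
      exact: rot_cycle2_prev_end.
    by apply: rot_cycle2_prev; lia.
  have [e1 e2 e3] := rot_leaf s.
  have hj3 : j = 2 * k + 2 \/ j = 2 * k + 3 \/ j = 2 * k + 4 by lia.
  by case: hj3 => [->|[->|->]]; apply: (@expg_fix_dvd _ 3) => //;
    rewrite 2!expgS expg1 2!permM !(e1, e2, e3).
Qed.

Lemma rot_leaf_dvd s n : (rot s ^+ n)%g (pt (s + 2)%R (2 * k + 4)) = pt (s + 2)%R (2 * k + 4) ->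
  3 %| n.
Proof.
have [e1 e2 e3] := rot_leaf s.
have r3 : (rot s ^+ (3 * (n %/ 3)))%g (pt (s + 2)%R (2 * k + 4)) = pt (s + 2)%R (2 * k + 4).
  apply: (@expg_fix_dvd _ 3); last exact: dvdn_mulr.
  by rewrite 2!expgS expg1 2!permM !(e1, e2, e3).
rewrite {1}(divn_eq n 3) mulnC expgD permM r3 /dvdn.
have := ltn_pmod n (isT : 0 < 3).
case: (n %% 3) => [|[|[|//]]] // _.
  by rewrite expg1 e1; case/pt_inj; lia.
by rewrite expgS expg1 permM e1 e2; case/pt_inj; lia.
Qed.

(** Indexed by its first generator, in cyclic order; its type as a parabolic is [s + 2]. *)
Definition par (s : 'I_3) : {group 'S_(deg k)} := <<[set rho s; rho (s + 1)%R]>>%G.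

Lemma par_id s : rho s \in par s. Proof. by rewrite mem_gen // set21. Qed.
Lemma par_next s : rho (s + 1)%R \in par s. Proof. by rewrite mem_gen // set22. Qed.

Lemma parP s g : g \in par s -> exists n, g = (rot s ^+ n)%g \/ g = (rot s ^+ n * rho s)%g.
Proof. by apply: dihedral_genP; apply: rho_invol. Qed.

Lemma par_affine s g : g \in par s -> exists c : int,
  (forall r, g (chart s r) = chart s (r + c)%R) \/ (forall r, g (chart s r) = chart s (c - r)%R).
Proof.
case/parP => n [->|->]; first by exists (n%:Z)%R; left => r; rewrite rotX_chart.
exists (2 - n%:Z)%R; right => r; rewrite permM rotX_chart rho_chart.
by congr (chart _ _); lia.
Qed.

(** * Generators and triality *)

Lemma G_gen : G k = <<[set rho i | i : 'I_3]>>%g :> {set 'S_(deg k)}.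
Proof.
congr (<<_>>)%g; apply/setP => g; apply/idP/imsetP.
  by rewrite !inE -orbA => /or3P[]/eqP->; [exists 0%R | exists 1%R | exists 2%R].
by case=> -[[|[|[|//]]]] ? _ ->; rewrite /rho /= !inE eqxx ?orbT.
Qed.

Lemma rho_G i : rho i \in G k.
Proof. by rewrite G_gen mem_gen ?imset_f. Qed.

Lemma parabolic_par i : parabolic k i = par (i + 1)%R.
Proof.
apply: val_inj; rewrite /=.
by case: i => [[|[|[|//]]]] ?; rewrite /parabolic /= 1?setUC.
Qed.

Lemma parabolic_gen i : parabolic k i = <<[set rho (i + 1)%R; rho (i + 2)%R]>>%g :> {set _}.
Proof. by rewrite parabolic_par /= ord3_add. Qed.

Lemma prod_transp_odd n (a b : nat -> nat) :
  (forall i, i < n -> transp k (a i) (b i) != 1%g) ->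
  odd_perm (\prod_(i < n) transp k (a i) (b i))%g = odd n.
Proof.
elim: n => [|n IH] h; first by rewrite big_ord0 odd_perm1.
rewrite big_ord_recr odd_permM IH /=; last by move=> i hi; apply: h; lia.
have -> : odd_perm (transp k (a n) (b n)); last by rewrite addbT.
by rewrite odd_tperm; apply: contraNneq (h n (ltnSn n)) => e; rewrite /transp e tperm1.
Qed.

Lemma transp_odd a b : 0 < a <= deg k -> 0 < b <= deg k -> a != b -> odd_perm (transp k a b).
Proof.
by move=> ha hb ab; rewrite odd_tperm; apply: contraNneq ab => /letter_inj ->.
Qed.

Lemma transp_neq1 a b : 0 < a <= deg k -> 0 < b <= deg k -> a != b -> transp k a b != 1%g.
Proof.
by move=> ha hb ab; apply: contraTneq (transp_odd ha hb ab) => ->; rewrite odd_perm1.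
Qed.

(** [rho1] is a product of 2(k + 1) + 3 transpositions. *)
Lemma rho1_odd : odd_perm (rho 0%R).
Proof.
rewrite /rho /= /rho1 !odd_permM.
rewrite (prod_transp_odd (a := fun i => 4 + 6 * i) (b := fun i => 7 + 6 * i)); last first.
  by move=> i hi; apply: transp_neq1; rewrite /deg; lia.
rewrite (prod_transp_odd (a := fun i => 5 + 6 * i) (b := fun i => 8 + 6 * i)); last first.
  by move=> i hi; apply: transp_neq1; rewrite /deg; lia.
rewrite !transp_odd; try (rewrite /deg; lia).
Qed.

(* Triality: rotates the three arms of the permutation graph. *)
Definition turn_letter (x : 'I_(deg k)) : 'I_(deg k) :=
  if x == 0 :> nat then ctr else
  if x.-1 %% 3 == 2 then letter k x.-1 else letter k x.+2.

Lemma turn_ctr : turn_letter ctr = ctr.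
Proof. by rewrite /turn_letter /ctr /letter /= inordK. Qed.

Lemma turn_pt s j : j <= 2 * k + 4 -> turn_letter (pt s j) = pt (s + 1)%R j.
Proof.
move=> hj; have hs := ltn_ord s.
have v : (pt s j : nat) = 1 + s + 3 * j by rewrite /pt /letter /= inordK //; lia.
rewrite /turn_letter v /pt.
have v1 : ((s + 1)%R : nat) = if s == 2 :> nat then 0 else s.+1.
  by case: (s) => [[|[|[|//]]]].
by rewrite v1; split_ifs; apply: letter_eq; lia.
Qed.

Lemma turn_inj : injective turn_letter.
Proof.
move=> x y; case: (pointP x) => [->|[s [i [hi ->]]]]; case: (pointP y) => [->|[t [j [hj ->]]]] //;
  rewrite ?turn_ctr ?turn_pt //.
- by move/esym/pt_neq_ctr => /(_ hj).
- by move/pt_neq_ctr => /(_ hi).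
by case/pt_inj => // /addIr -> ->.
Qed.

Definition turn : 'S_(deg k) := perm turn_inj.

Lemma rho_turn i : (rho i ^ turn = rho (i + 1)%R)%g.
Proof.
apply/permP => z; have [x ->] : exists x, z = turn x by exists (turn^-1%g z); rewrite permKV.
rewrite permJ; case: (pointP x) => [->|[t [j [hj ->]]]].
  by rewrite rho_ctr ![turn _]permE turn_ctr rho_ctr turn_pt.
rewrite rho_pt // ![turn _]permE turn_pt // rho_pt //.
have -> : (i + 1 - (t + 1) = i - t)%R by rewrite opprD addrACA subrr addr0.
have : forall j', step (i - t)%R j = Some j' -> j' <= 2 * k + 4.
  by case: (ord3_cases t i) => -> j'; rewrite step_sub ?step0 ?step1 ?step2; split_ifs; case; try lia.
by rewrite /opt_pt; case: (step _ j) => [j' /(_ _ erefl) h|_]; rewrite ?turn_pt ?turn_ctr.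
Qed.

Hypothesis k1 : 1 <= k.

(** For k at least 1 the period is at least 8. Most comparisons of nearby points of a path below
    rest on this bound. *)
Lemma per_small (d : int) : (per%:Z %| d)%Z -> (`|d| < 8)%R -> d = 0%R.
Proof.
case/dvdzP => q ->; rewrite /per => h.
have [->|[q0|q0]] : (q = 0 \/ 1 <= q \/ q <= -1)%R by lia.
- by rewrite mul0r.
- by exfalso; nia.
- by exfalso; nia.
Qed.

(** * The kernel of the action on a long path *)

Lemma par_trivial s g : g \in par s -> (forall r, g (chart s r) = chart s r) ->
  exists2 n, g = (rot s ^+ n)%g & per %| n.
Proof.
case/parP => n [->|->] h.
  by exists n => //; have := h 0%R; rewrite rotX_chart => /chart_inj; rewrite add0r subr0.
(* A reflection fixing the coordinates 0 and 1 would make the period divide 2. *)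
exfalso; have := h 0%R; have := h 1%R.
rewrite !permM !rotX_chart !rho_chart => /chart_inj h1 /chart_inj h2.
have := rpredB h2 h1.
have -> : (2 - (0 + n%:Z) - 0 - (2 - (1 + n%:Z) - 1) = 2)%R by ring.
by move/per_small => /(_ isT).
Qed.

(** A kernel element is a power of [rot s] with exponent divisible by the even number [per]. Fixing
    a leaf in an orbit of length 3 makes the exponent a multiple of 6, and [rotX6] finishes. *)
Lemma par_trivial_eq1 s g : g \in par s -> (forall r, g (chart s r) = chart s r) ->
  g (pt (s + 2)%R (2 * k + 4)) = pt (s + 2)%R (2 * k + 4) -> g = 1%g.
Proof.
move=> gs gtriv gleaf; have [n gn pn] := par_trivial gs gtriv.
have n6 : 6 %| n.
  rewrite (@Gauss_dvd 2 3) // (rot_leaf_dvd (s := s)) -?gn // andbT.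
  by apply: dvdn_trans pn; rewrite /per; apply/dvdnP; exists (k + 3); lia.
apply/permP => x; rewrite perm1; case: (chartP s x) => [[r ->]|/(rotX6 n6)]; first by rewrite gtriv.
by rewrite -gn.
Qed.

Lemma par_trivial_prev s g : g \in par s -> (forall r, g (chart s r) = chart s r) ->
  g (pt (s + 2)%R 0) = pt (s + 2)%R 0.
Proof.
move=> gs gtriv; have [n -> pn] := par_trivial gs gtriv.
apply: (@expg_fix_dvd _ 2); first exact: rot_cycle2_prev.
by apply: dvdn_trans pn; rewrite /per; apply/dvdnP; exists (k + 3); lia.
Qed.

(** * The factorization condition *)

Lemma rhoK s x : rho s (rho s x) = x.
Proof. by rewrite -permM rho_invol perm1. Qed.

Lemma rho1_pt0 t : rho (t + 1)%R (pt t 0) = pt t 1.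
Proof. by act. Qed.

Lemma charted_leaf t : charted t (pt t (2 * k + 4)).
Proof. by apply: charted_arm; lia. Qed.

Lemma rho_leaf t : rho t (pt t (2 * k + 4)) = pt t (2 * k + 4).
Proof. by act. Qed.

Lemma rho2_leaf t : rho (t + 2)%R (pt t (2 * k + 4)) = pt t (2 * k + 4).
Proof. by act. Qed.

Lemma par_stable s (S : 'I_(deg k) -> Prop) g x :
  (forall y, S y -> S (rho s y)) -> (forall y, S y -> S (rho (s + 1)%R y)) ->
  g \in par s -> S x -> S (g x).
Proof. by move=> S1 S2; apply: gen_stable => h y /set2P[] ->; auto. Qed.

Lemma par_charted s g x : g \in par s -> charted s x -> charted s (g x).
Proof.
move=> gs [r ->]; case: (par_affine gs) => c [->|->].
  by exists (r + c)%R.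
by exists (c - r)%R.
Qed.

Definition off_arm s (x : 'I_(deg k)) := forall j, 0 < j <= 2 * k + 4 -> x <> pt s j.

(** The edge between the first two points of arm [s] is labelled [s + 1], so [rho s] and
    [rho (s + 2)] cannot enter the arm beyond its first point. *)
Lemma par_off_arm s g x : g \in par (s + 2)%R -> off_arm s x -> off_arm s (g x).
Proof.
move=> gs; apply: par_stable gs => y hy j hj e; rewrite ?ord3_add in e.
  have {}e : y = rho (s + 2)%R (pt s j) by rewrite -e rhoK.
  by move: e; act => eqn; apply: hy eqn; lia.
have {}e : y = rho s (pt s j) by rewrite -e rhoK.
by move: e; act => eqn; apply: hy eqn; lia.
Qed.

Lemma charted_off_arm s x : charted (s + 1)%R x -> off_arm s x.
Proof.
have [n1 n2 n3] := ord3_neq s.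
case=> r -> j hj; case: (chart_cases (s + 1)%R r) => [->|->|[i [hi _ ->]]] e.
- by move/esym/pt_neq_ctr: e; lia.
- by case/pt_inj: e; lia.
- by case/pt_inj: e; try lia; ord_absurd n1 n2 n3.
Qed.

Lemma charted_meet s x : charted s x -> charted (s + 1)%R x ->
  x = ctr \/ x = pt (s + 1)%R 0.
Proof.
have [n1 n2 n3] := ord3_neq s.
move=> [r ->] [r' e]; move: e.
case: (chart_cases s r) => [->|->|[j [hj _ ->]]]; auto.
case: (chart_cases (s + 1)%R r') => [->|->|[i [hi _ ->]]] e; rewrite ?ord3_add in e.
- by move/pt_neq_ctr: e; lia.
- by case/pt_inj: e => //; ord_absurd n1 n2 n3.
- by case/pt_inj: e => //; ord_absurd n1 n2 n3.
Qed.

Lemma chart_dec s (r r' : int) : chart s r = chart s r' -> (`|r - r'| < 8)%R -> r = r'.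
Proof. by move/chart_inj/per_small => h /h; lia. Qed.

Lemma chart_near s r : off_arm s (chart s r) ->
  [\/ chart s r = chart s 0%R, chart s r = chart s 1%R | chart s r = chart s 2%R].
Proof.
rewrite chart0 chart1 chart2.
case: (chart_cases s r) => [->|->|[j [hj _ ->]]] h; [by constructor 1|by constructor 2|].
case: (posnP j) => [->|j0]; first by constructor 3.
by case: (h j) => //; lia.
Qed.

(** [rho (s + 2)] exchanges these two points and [rho s] fixes both. *)
Lemma par_two_pair s g x : g \in par (s + 2)%R ->
  x = pt (s + 1)%R 0 \/ x = pt (s + 1)%R 1 -> g x = pt (s + 1)%R 0 \/ g x = pt (s + 1)%R 1.
Proof.
pose S x := x = pt (s + 1)%R 0 \/ x = pt (s + 1)%R 1.
move=> gs; apply: (@par_stable _ S) gs => y [->|->]; rewrite ?ord3_add /S; act; auto.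
Qed.

(** An affine map taking 0 and 1 into {0, 1, 2} is r, r + 1, 1 - r or 2 - r. Each is undone by r ->
    1 - r before or r -> 2 - r after it, or both, or neither. *)
Lemma affine_near s g : g \in par s ->
  (forall r, r = 0%R \/ r = 1%R ->
    [\/ g (chart s r) = chart s 0%R, g (chart s r) = chart s 1%R | g (chart s r) = chart s 2%R]) ->
  exists f2 f3, [/\ f2 = 1%g \/ f2 = rho (s + 1)%R, f3 = 1%g \/ f3 = rho s
    & forall r, (f2 * g * f3)%g (chart s r) = chart s r].
Proof.
move=> gs h; have := h 1%R (or_intror erefl); have := h 0%R (or_introl erefl).
case: (par_affine gs) => c [] gc; rewrite !gc => h0 h1.
- have hc : chart s c = chart s 0%R \/ chart s c = chart s 1%R.
    move: h0 h1; rewrite add0r => -[]; auto => /chart_inj d0 [] /chart_inj d1; exfalso.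
    + by have := rpredB d1 d0; rewrite (_ : _ - _ = 3)%R; [move/per_small=> /(_ isT)|ring].
    + by have := rpredB d1 d0; rewrite (_ : _ - _ = 2)%R; [move/per_small=> /(_ isT)|ring].
    + by have := rpredB d1 d0; rewrite (_ : _ - _ = 1)%R; [move/per_small=> /(_ isT)|ring].
  case: hc => /chart_inj hc.
    exists 1%g, 1%g; split; auto => r; rewrite mul1g mulg1 gc; apply: chart_per.
    by rewrite (_ : _ - _ = c - 0)%R //; ring.
  exists (rho (s + 1)%R), (rho s); split; auto => r.
  rewrite !permM rho1_chart gc rho_chart; apply: chart_per.
  by rewrite (_ : _ - _ = - (c - 1))%R ?rpredN //; ring.
- have hc : chart s c = chart s 1%R \/ chart s c = chart s 2%R.
    move: h0 h1; rewrite subr0 => -[]; auto => /chart_inj d0 [] /chart_inj d1; exfalso.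
    + by have := rpredB d1 d0; rewrite (_ : _ - _ = -1)%R; [move/per_small=> /(_ isT)|ring].
    + by have := rpredB d1 d0; rewrite (_ : _ - _ = - 2)%R; [move/per_small=> /(_ isT)|ring].
    + by have := rpredB d1 d0; rewrite (_ : _ - _ = - 3)%R; [move/per_small=> /(_ isT)|ring].
  case: hc => /chart_inj hc.
    exists (rho (s + 1)%R), 1%g; split; auto => r; rewrite mulg1 permM rho1_chart gc.
    by apply: chart_per; rewrite (_ : _ - _ = c - 1)%R //; ring.
  exists 1%g, (rho s); split; auto => r; rewrite mul1g permM gc rho_chart.
  by apply: chart_per; rewrite (_ : _ - _ = - (c - 2))%R ?rpredN //; ring.
Qed.

(** Only the identity and r -> 1 - r meet both conditions; subtracting the congruences in any other
    case leaves a small nonzero multiple of the period. *)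
Lemma affine_near2 s g : g \in par s ->
  g (chart s 0%R) = chart s 0%R \/ g (chart s 0%R) = chart s 1%R ->
  g (chart s 2%R) = chart s 2%R \/ g (chart s 2%R) = chart s (-1)%R ->
  exists2 e, e = 1%g \/ e = rho (s + 1)%R & forall r, (g * e)%g (chart s r) = chart s r.
Proof.
move=> gs; case: (par_affine gs) => c [] gc; rewrite !gc.
- rewrite add0r => -[] /chart_inj d0.
    move=> _; exists 1%g; auto => r; rewrite mulg1 gc; apply: chart_per.
    by rewrite (_ : _ - _ = c - 0)%R //; ring.
  case=> /chart_inj d1; exfalso.
  + by have := rpredB d1 d0; rewrite (_ : _ - _ = 1)%R; [move/per_small=> /(_ isT)|ring].
  + by have := rpredB d1 d0; rewrite (_ : _ - _ = 4)%R; [move/per_small=> /(_ isT)|ring].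
- rewrite subr0 => -[] /chart_inj d0; last first.
    move=> _; exists (rho (s + 1)%R); auto => r; rewrite permM gc rho1_chart.
    by apply: chart_per; rewrite (_ : _ - _ = - (c - 1))%R ?rpredN //; ring.
  case=> /chart_inj d1; exfalso.
  + by have := rpredB d1 d0; rewrite (_ : _ - _ = -4)%R; [move/per_small=> /(_ isT)|ring].
  + by have := rpredB d1 d0; rewrite (_ : _ - _ = -1)%R; [move/per_small=> /(_ isT)|ring].
Qed.

Lemma par_factor s g2 g3 : g2 \in par (s + 1)%R -> g3 \in par (s + 2)%R ->
  (g2 * g3)%g \in par s ->
  exists f2 f3, [/\ f2 = 1%g \/ f2 = rho (s + 1)%R, f3 = 1%g \/ f3 = rho s
    & (g2 * g3 = f2 * f3)%g].
Proof.
move=> g2s g3s gs.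
have inv1 s' f : f = 1%g \/ f = rho s' -> (f * f = 1)%g.
  by case=> ->; rewrite ?mulg1 ?rho_invol.
(* Both points lie on the long path of [s + 1], where [g2] keeps them, hence off arm [s] beyond its
   first point; [g3] keeps them off it. Their final images lie on the path of [s], so only the
   coordinates 0, 1 and 2 remain. *)
have hnear r : r = 0%R \/ r = 1%R ->
    [\/ (g2 * g3)%g (chart s r) = chart s 0%R, (g2 * g3)%g (chart s r) = chart s 1%R
      | (g2 * g3)%g (chart s r) = chart s 2%R].
  move=> hr; have : charted s ((g2 * g3)%g (chart s r)) by apply: par_charted => //; exists r.
  case=> r' e; rewrite e; apply: chart_near.
  rewrite -e permM; apply: par_off_arm g3s _; apply: charted_off_arm.
  apply: par_charted => //; case: hr => ->; rewrite ?chart0 ?chart1; first exact: charted_ctr.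
  by rewrite -chart2; exists 2%R.
have [f2 [f3 [hf2 hf3 htriv]]] := affine_near gs hnear.
have f2s : f2 \in par s by case: hf2 => ->; rewrite ?group1 ?par_next.
have f3s : f3 \in par s by case: hf3 => ->; rewrite ?group1 ?par_id.
have f2s1 : f2 \in par (s + 1)%R by case: hf2 => ->; rewrite ?group1 ?par_id.
have f3s2 : f3 \in par (s + 2)%R.
  by case: hf3 => ->; rewrite ?group1 //; have := par_next (s + 2)%R; rewrite ord3_add.
exists f2, f3; split=> //.
(* It remains to see that f2 g f3 = h2 h3 is trivial; it is on the chart of s. *)
pose h2 := (f2 * g2)%g; pose h3 := (g3 * f3)%g.
have h2s : h2 \in par (s + 1)%R by rewrite groupM.
have h3s : h3 \in par (s + 2)%R by rewrite groupM.
pose h := (h2 * h3)%g; have hE : h = (f2 * (g2 * g3) * f3)%g by rewrite /h /h2 /h3 !mulgA.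
have hs : h \in par s by rewrite hE; apply: groupM => //; apply: groupM.
clearbody h2 h3.
have htr r : h (chart s r) = chart s r by rewrite hE htriv.
have e0 : h2 ctr = (h3^-1)%g ctr.
  by apply: (@perm_inj _ h3); rewrite permKV -permM -/h -(chart0 s) htr.
have e2 : h2 (pt (s + 1)%R 0) = (h3^-1)%g (pt (s + 1)%R 0).
  by apply: (@perm_inj _ h3); rewrite permKV -permM -/h -(chart1 s) htr.
(* [h2] and the inverse of [h3] agree on the centre and on [pt (s + 1) 0]. The common image of the
   centre lies on the paths of both [s + 1] and [s + 2], that of the other point in the orbit of
   [par_two_pair]. So [h2] acts on its path as 1 or as [rho (s + 2)], which is moved over to
   [h3]. *)
have [e he etr] : exists2 e, e = 1%g \/ e = rho (s + 1 + 1)%R &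
    forall r, (h2 * e)%g (chart (s + 1)%R r) = chart (s + 1)%R r.
  apply: affine_near2 => //; rewrite ?chart0 ?chart1 ?chart2.
    apply: charted_meet; first by apply: par_charted (charted_ctr _).
    by rewrite ord3_add e0; apply: par_charted (charted_ctr _); rewrite groupV.
  rewrite (_ : chart (s + 1)%R (-1)%R = pt (s + 1)%R 1); last first.
    by rewrite (_ : -1 = 1 - 2)%R // -rho1_chart chart2 rho1_pt0.
  by rewrite e2; apply: par_two_pair; rewrite ?groupV //; left.
rewrite ord3_add in he.
have es1 : e \in par (s + 1)%R.
  by case: he => ->; rewrite ?group1 //; have := par_next (s + 1)%R; rewrite ord3_add.
have es2 : e \in par (s + 2)%R by case: he => ->; rewrite ?group1 ?par_id.
pose k2 := (h2 * e)%g; pose k3 := (e * h3)%g.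
have hk : h = (k2 * k3)%g.
  by rewrite /k2 /k3 /h -mulgA (mulgA e) (inv1 _ _ he) mul1g.
have k3s : k3 \in par (s + 2)%R by rewrite groupM.
(* [k2] is now trivial on its path and [h] fixes both points considered, so [k3] fixes the
   coordinates 0 and 2 of its own path, hence that whole path. *)
have k30 : k3 (chart (s + 2)%R 0%R) = chart (s + 2)%R 0%R.
  rewrite chart0 -[in LHS](chart0 (s + 1)%R) -etr -permM -/k2 -hk.
  by rewrite chart0 -(chart0 s) htr.
have k32 : k3 (chart (s + 2)%R 2%R) = chart (s + 2)%R 2%R.
  have c1 : chart (s + 1)%R 1%R = pt (s + 2)%R 0 by rewrite chart1 ord3_add.
  rewrite chart2 -[in LHS]c1 -etr -permM -/k2 -hk c1.
  exact: (par_trivial_prev hs htr).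
have k3tr r : k3 (chart (s + 2)%R r) = chart (s + 2)%R r.
  case: (par_affine k3s) => c [] kc; move: k30 k32; rewrite !kc.
    by rewrite add0r => /chart_inj d0 _; apply: chart_per; rewrite (_ : _ - _ = c - 0)%R //; ring.
  rewrite subr0 => /chart_inj d0 /chart_inj d1; exfalso; have := rpredB d1 d0.
  by rewrite (_ : _ - _ = -4)%R; [move/per_small=> /(_ isT)|ring].
(* The leaf demanded by [par_trivial_eq1] is fixed by both generators of [par (s + 1)] and lies on
   the path on which [k3] is trivial. *)
have h1 : h = 1%g.
  apply: (par_trivial_eq1 hs htr); rewrite hk permM.
  have [r rE] := charted_leaf (s + 2)%R.
  suff -> : k2 (pt (s + 2)%R (2 * k + 4)) = pt (s + 2)%R (2 * k + 4) by rewrite rE k3tr.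
  pose S x := x = pt (s + 2)%R (2 * k + 4).
  apply: (@par_stable (s + 1)%R S); rewrite /S //.
  - by move=> y ->; have := rho2_leaf (s + 2)%R; rewrite ord3_add.
  - by move=> y ->; rewrite ord3_add rho_leaf.
  - by rewrite groupM.
move: h1; rewrite hE => e1.
have -> : (g2 * g3 = f2 * (f2 * (g2 * g3) * f3) * f3)%g.
  by rewrite !mulgA (inv1 _ _ hf2) mul1g -!mulgA (inv1 _ _ hf3) mulg1.
by rewrite e1 mulg1.
Qed.

(** Factorization with [g3 = 1] leaves only the possibility that [rho s] lies in [par (s + 1)]; but
    it takes the centre to a point off the long path of [s + 1]. *)
Lemma par_meet s g : g \in par s -> g \in par (s + 1)%R -> g = 1%g \/ g = rho (s + 1)%R.
Proof.
move=> gs gs1.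
have := @par_factor s g 1%g gs1 (group1 _); rewrite mulg1 => /(_ gs).
case=> f2 [f3 [hf2 [->|hf3] e]]; first by rewrite e mulg1.
have f2s1 : f2 \in par (s + 1)%R by case: hf2 => ->; rewrite ?group1 ?par_id.
have : f3 \in par (s + 1)%R by rewrite -(groupMl _ f2s1) -e.
move=> f3s1; exfalso; have : charted (s + 1)%R (f3 ctr) by apply: par_charted (charted_ctr _).
case=> r; rewrite hf3 rho_ctr => er.
have [n1 n2 n3] := ord3_neq s.
case: (chart_cases (s + 1)%R r) => [e'|e'|[i [hi _ e']]]; rewrite -er in e'.
- by move: e'; apply: pt_neq_ctr.
- by rewrite ord3_add in e'; case/pt_inj: e' => //; ord_absurd n1 n2 n3.
- by case/pt_inj: e' => //; ord_absurd n1 n2 n3.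
Qed.

Lemma rho_notin_par s : rho s \notin par (s + 1)%R.
Proof.
apply/negP => h; have : charted (s + 1)%R (rho s ctr) by apply: par_charted (charted_ctr _).
case=> r; rewrite rho_ctr => er; have [n1 n2 n3] := ord3_neq s.
case: (chart_cases (s + 1)%R r) => [e'|e'|[i [hi _ e']]]; rewrite -er in e'.
- by move: e'; apply: pt_neq_ctr.
- by rewrite ord3_add in e'; case/pt_inj: e' => //; ord_absurd n1 n2 n3.
- by case/pt_inj: e' => //; ord_absurd n1 n2 n3.
Qed.

(** * A 3-cycle as a word in the generators *)

Lemma charted_meet_chart s r : charted (s + 1)%R (chart s r) ->
  (per%:Z %| r)%Z \/ (per%:Z %| (r - 1)%R)%Z.
Proof.
move=> h; case: (charted_meet (ex_intro _ r erefl) h) => e.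
  by left; move: e; rewrite -(chart0 s) => /chart_inj; rewrite subr0.
by right; move: e; rewrite -(chart1 s) => /chart_inj.
Qed.

Lemma charted_meet_chart1 s r : charted s (chart (s + 1)%R r) ->
  (per%:Z %| r)%Z \/ (per%:Z %| (r - 2)%R)%Z.
Proof.
move=> h; case: (charted_meet h (ex_intro _ r erefl)) => e.
  by left; move: e; rewrite -(chart0 (s + 1)%R) => /chart_inj; rewrite subr0.
by right; move: e; rewrite -(chart2 (s + 1)%R) => /chart_inj.
Qed.

(** The boolean gives the direction, which an exchange of generators reverses. *)
Definition spin s (b : bool) : 'S_(deg k) := if b then (rot s ^+ 6)%g else (rot s ^- 6)%g.
Definition angle (b : bool) : int := if b then 6%R else (-6)%R.

Lemma spin_chart s b r : spin s b (chart s r) = chart s (r + angle b)%R.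
Proof.
case: b => /=; first by rewrite rotX_chart.
by apply: (@perm_inj _ (rot s ^+ 6)%g); rewrite permKV rotX_chart subrK.
Qed.

Lemma spin_uncharted s b x : ~ charted s x -> spin s b x = x.
Proof.
move=> h; case: (chartP s x) => // hx; have e := @rotX6 s 6 x isT hx.
by case: b => //=; rewrite -{1}e permK.
Qed.

Lemma spinV s b : ((spin s b)^-1 = spin s (~~ b))%g.
Proof. by case: b; rewrite /= ?invgK. Qed.

Lemma spin_ctr s b : spin s b ctr = chart s (angle b).
Proof. by rewrite -(chart0 s) spin_chart add0r. Qed.

Lemma not_per (d : int) : d != 0%R -> (`|d| < 8)%R -> ~ (per%:Z %| d)%Z.
Proof. by move=> d0 d8 /per_small /(_ d8) e; rewrite e in d0. Qed.

Lemma spin_fix s b r : ~ (per%:Z %| r)%Z -> ~ (per%:Z %| (r - 1)%R)%Z ->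
  spin (s + 1)%R b (chart s r) = chart s r.
Proof. by move=> h0 h1; apply: spin_uncharted => /charted_meet_chart[]. Qed.

Lemma spin_fix1 s b r : ~ (per%:Z %| r)%Z -> ~ (per%:Z %| (r - 2)%R)%Z ->
  spin s b (chart (s + 1)%R r) = chart (s + 1)%R r.
Proof. by move=> h0 h1; apply: spin_uncharted => /charted_meet_chart1[]. Qed.

Lemma chart_neq s (r r' : int) : r != r' -> (`|r - r'| < 8)%R -> chart s r != chart s r'.
Proof. by move=> h d; apply/eqP => /chart_dec /(_ d) e; rewrite e eqxx in h. Qed.

Lemma chart_chart2 s : chart s 1%R = chart (s + 1)%R 2%R.
Proof. by rewrite chart1 chart2. Qed.

(** The paths of [s] and [s + 1] meet in the centre and in [chart s 1], the points p and q of
    [commg_commg_cycle3]. The directions keep all differences of coordinates below 8: turning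
    [spin (s + 1)] the other way would take coordinate 2 to 8, which is the period for [k = 1]. *)
Lemma triple_commg s :
  [~ [~ spin (s + 1)%R false, spin s true], spin (s + 2)%R true]%g
  = cycle3 ctr (chart (s + 2)%R 6%R) (chart s 6%R).
Proof.
have fixW2 r : ~ (per%:Z %| r)%Z -> ~ (per%:Z %| (r - 2)%R)%Z ->
    spin (s + 2)%R true (chart s r) = chart s r.
  by have := @spin_fix1 (s + 2)%R true r; rewrite ord3_add.
have fixW1 r : ~ (per%:Z %| r)%Z -> ~ (per%:Z %| (r - 1)%R)%Z ->
    spin (s + 2)%R true (chart (s + 1)%R r) = chart (s + 1)%R r.
  by have := @spin_fix (s + 1)%R true r; rewrite ord3_add.
rewrite (@commg_commg_cycle3 _ _ _ _ ctr (chart s 1%R)) ?spin_ctr //.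
- move=> u u0 u1; case: (chartP s u) => [cu|nu]; last first.
    by left; apply: spin_uncharted => /unchartedP; apply.
  right; apply: spin_uncharted => cu1; case: (charted_meet cu cu1) => e.
    by rewrite e eqxx in u0.
  by rewrite e chart1 eqxx in u1.
- move=> u; rewrite spin_chart {2}chart_chart2 spin_chart !inE /angle => hu _.
  by case/or4P: hu => [/eqP->|/eqP->|/eqP->|/orP[]/eqP->];
    first [apply: fixW2 | apply: fixW1]; apply: not_per.
- by rewrite spinV spin_ctr spin_fix1 //; apply: not_per.
- by rewrite -(chart0 s) chart_neq.
- by rewrite -(chart0 (s + 2)%R) chart_neq.
Qed.

(* The word obtained from triple_commg by exchanging rho s and rho (s + 1). *)
Lemma triple_commg_swap s :
  [~ [~ spin (s + 2)%R true, spin s false], spin (s + 1)%R false]%g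
  = cycle3 ctr (chart (s + 1)%R (-6)%R) (chart s (-6)%R).
Proof.
have fixW2 r : ~ (per%:Z %| r)%Z -> ~ (per%:Z %| (r - 2)%R)%Z ->
    spin (s + 1)%R false (chart (s + 2)%R r) = chart (s + 2)%R r.
  by have := @spin_fix1 (s + 1)%R false r; rewrite ord3_add.
have fixX r : ~ (per%:Z %| r)%Z -> ~ (per%:Z %| (r - 1)%R)%Z ->
    spin s false (chart (s + 2)%R r) = chart (s + 2)%R r.
  by have := @spin_fix (s + 2)%R false r; rewrite ord3_add.
have c21 : chart s 2%R = chart (s + 2)%R 1%R by have := chart_chart2 (s + 2)%R; rewrite ord3_add.
rewrite (@commg_commg_cycle3 _ _ _ _ ctr (chart s 2%R)) ?spin_ctr //.
- move=> u u0 u1; case: (chartP s u) => [cu|nu]; last first.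
    by left; apply: spin_uncharted => /unchartedP; apply.
  right; apply: spin_uncharted => cu1.
  have := @charted_meet (s + 2)%R u cu1; rewrite ord3_add => /(_ cu) [] e.
    by rewrite e eqxx in u0.
  by rewrite e chart2 eqxx in u1.
- move=> u; rewrite spin_chart {2}c21 spin_chart !inE /angle => hu _.
  by case/or4P: hu => [/eqP->|/eqP->|/eqP->|/orP[]/eqP->];
    first [apply: spin_fix | apply: fixW2]; apply: not_per.
- by rewrite spinV spin_ctr fixX //; apply: not_per.
- by rewrite -(chart0 s) chart_neq.
- by rewrite -(chart0 (s + 1)%R) chart_neq.
Qed.

(** * No dualities *)

Lemma not_per_odd (d : int) : ~ (per%:Z %| (2 * d + 1)%R)%Z.
Proof.
case/dvdzP => q; rewrite /per (_ : q * _ = q * (k%:Z + 3) * 2)%R; last by lia.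
by move: (q * _)%R => p; lia.
Qed.

Lemma par_charted_inv s g x : g \in par s -> charted s (g x) -> charted s x.
Proof. by move=> gs h; rewrite -(permK g x); apply: par_charted; rewrite ?groupV. Qed.

Lemma rot_inv s : ((rot s)^-1 = rho s * rho (s + 1)%R)%g.
Proof. by rewrite /rot invMg !invol_inv // rho_invol. Qed.

Lemma spin_corresp s t tau b c : corresp rho tau (rot s) ((rot t) ^- 1)%g -> c = ~~ b ->
  corresp rho tau (spin s b) (spin t c).
Proof.
move=> h ->; have h6 := correspX 6 h; rewrite expVgn expg1 in h6.
have rV := @correspV _ rho tau (@rho_invol).
by case: b => //=; have := rV _ _ h6; rewrite invgK.
Qed.

Lemma no_swap s (tau : {perm 'I_3}) : tau s = (s + 1)%R -> tau (s + 1)%R = s ->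
  (forall w, word rho w = 1%g -> word rho (map tau w) = 1%g) -> False.
Proof.
move=> t0 t1 hw.
have t2 : tau (s + 2)%R = (s + 2)%R.
  have [n1 n2 n3] := ord3_neq s.
  case: (ord3_cases s (tau (s + 2)%R)) => // e; exfalso.
    by move: n3; rewrite -(inj_eq (@perm_inj _ tau)) e t1 eqxx.
  by move: n2; rewrite -(inj_eq (@perm_inj _ tau)) e t0 eqxx.
have h1 g' : corresp rho tau 1%g g' -> g' = 1%g by case=> w [/hw e <-].
have r2 := @rho_invol.
have cg := @corresp_gen _ rho tau.
have c0 : corresp rho tau (rho s) (rho (s + 1)%R) by have := cg s; rewrite t0.
have c1 : corresp rho tau (rho (s + 1)%R) (rho s) by have := cg (s + 1)%R; rewrite t1.
have c2 : corresp rho tau (rho (s + 2)%R) (rho (s + 2)%R) by have := cg (s + 2)%R; rewrite t2.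
have ra : corresp rho tau (rot s) ((rot s) ^- 1)%g.
  by rewrite expg1 rot_inv; apply: correspM.
have rb : corresp rho tau (rot (s + 1)%R) ((rot (s + 2)%R) ^- 1)%g.
  by rewrite expg1 rot_inv /rot !ord3_add; apply: correspM.
have rc : corresp rho tau (rot (s + 2)%R) ((rot (s + 1)%R) ^- 1)%g.
  by rewrite expg1 rot_inv /rot !ord3_add; apply: correspM.
have cT := correspR r2 (correspR r2 (spin_corresp rb (erefl (~~ false))) (spin_corresp ra (erefl (~~ true))))
  (spin_corresp rc (erefl (~~ true))).
rewrite /= triple_commg // triple_commg_swap // in cT.
set p1 := chart (s + 2)%R 6%R in cT; set q := chart s 6%R in cT.
set p' := chart (s + 1)%R (-6)%R in cT; set q' := chart s (-6)%R in cT.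
set T := cycle3 _ _ _ in cT; set T' := cycle3 _ _ _ in cT.
(* [u] is the reflection r -> 6 - r, which exchanges the points [ctr] and [q] of [T]; its
   counterpart [u'] is r -> -3 - r and takes [ctr] and [q'] to the coordinates -3 and 3. *)
pose u := (rho s * rot s ^+ 4)%g; pose u' := (rho (s + 1)%R * ((rot s)^-1) ^+ 4)%g.
have cu : corresp rho tau u u'.
  by apply: correspM => //; apply: correspX; have := ra; rewrite expg1.
have uE r : u (chart s r) = chart s (6 - r)%R.
  by rewrite permM rho_chart rotX_chart; congr (chart _ _); ring.
have u'E r : u' (chart s r) = chart s (-3 - r)%R.
  rewrite permM rho1_chart expVgn; apply: (@perm_inj _ (rot s ^+ 4)%g).
  by rewrite permKV rotX_chart; congr (chart _ _); ring.
have us : u \in par s by rewrite groupM ?par_id // groupX // groupM ?par_id ?par_next.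
have u's : u' \in par s.
  by rewrite groupM ?par_next // groupX // groupV groupM ?par_id ?par_next.
have np1 : ~ charted s p1.
  have := @charted_meet_chart (s + 2)%R 6%R; rewrite ord3_add => h /h[]; exact: not_per.
have nup1 : ~ charted s (u p1) by move/(par_charted_inv us).
have off x r : ~ charted s x -> chart s r != x.
  by move=> nx; apply/eqP => e; case: nx; exists r.
have o0 : ctr = chart s 0%R by rewrite chart0.
have oq : ctr != q by rewrite o0 chart_neq.
have op1 : ctr != p1 by rewrite o0 off.
have qp1 : q != p1 by rewrite off.
have oup : ctr != u p1 by rewrite o0 off.
have qup : q != u p1 by rewrite off.
have oq' : ctr != q' by rewrite o0 chart_neq.
(* The second alternative occurs for k = 1 only, where -6 = 2 modulo m. *)
have hp' : ~ charted s p' \/ p' = chart s 1%R.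
  have [[r hr]|] := chartP s p'; last by move=> n; left => /unchartedP; apply.
  right; have /charted_meet_chart1[|] : charted s p' by exists r.
    by move=> h; exfalso; move: h; apply: not_per.
  by rewrite chart_chart2; apply: chart_per.
have p'off r : (`|r - 1| < 8)%R -> r != 1%R -> chart s r != p'.
  by move=> h h'; case: hp' => [/off|->]; [apply | rewrite chart_neq].
have u'p'off r : (`|r + 4| < 8)%R -> r != (-4)%R -> chart s r != u' p'.
  move=> h h'; case: hp' => [n|->]; first by apply: off => /(par_charted_inv u's).
  by rewrite u'E chart_neq.
have op' : ctr != p' by rewrite o0 p'off.
have q'p' : q' != p' by rewrite p'off.
have TuE : (T ^ u)%g = cycle3 q (u p1) ctr.
  by rewrite cycle3J o0 !uE.
have T'uE : (T' ^ u')%g = cycle3 (chart s (-3)%R) (u' p') (chart s 3%R).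
  by rewrite cycle3J o0 !u'E.
have T'uo : (T' ^ u')%g ctr = ctr.
  by rewrite T'uE cycle3_id // o0 ?u'p'off // chart_neq.
have T'uq : (T' ^ u')%g q' = q'.
  (* The coordinates differ by -9, too much for [per_small], but the period is even. *)
  have q'3 : q' != chart s 3%R.
    by apply/eqP => /chart_inj; apply: (@not_per_odd (-5)%R).
  by rewrite T'uE cycle3_id //; [exact: chart_neq | exact: u'p'off].
have T'o : T' ctr = p' by rewrite cycle3_1 // eq_sym.
(* If [u] fixes [p1], then [T ^ u] is the inverse of [T], whereas [(T' ^ u') * T'] takes the centre
   to [p']. *)
have [e|upn] := eqVneq (u p1) p1.
  have TT : ((T ^ u) * T = 1)%g.
    rewrite TuE e -(mulVg T) cycle3V [in RHS]cycle3C // eq_sym //.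
  have := correspM (correspJ r2 cT cu) cT; rewrite TT => /h1 /(congr1 (fun g : 'S__ => g ctr)).
  by rewrite permM T'uo T'o perm1 => /esym/eqP; rewrite (negPf op').
(* Otherwise [T^-1 * T ^ u] is a double transposition. Its counterpart takes the centre to [q'] and
   [q'] to the image of [p'] under [T' ^ u'], which is not the centre because [T' ^ u'] fixes the
   centre. *)
have TT : ((T^-1 * T ^ u) ^+ 2 = 1)%g.
  by rewrite TuE cycle3V cycle3_double_swap // eq_sym.
have := correspX 2 (correspM (correspV r2 cT) (correspJ r2 cT cu)).
rewrite TT => /h1 /(congr1 (fun g : 'S__ => g ctr)).
have T'Vo : (T'^-1)%g ctr = q' by rewrite cycle3V cycle3_1 // eq_sym.
have T'Vq : (T'^-1)%g q' = p' by rewrite cycle3V cycle3_2.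
move: T'uo T'uq; move: (T' ^ u')%g => V Vo Vq.
rewrite expgS expg1 perm1 3!permM T'Vo Vq T'Vq => e.
have /perm_inj/eqP : V ctr = V p' by rewrite Vo e.
by rewrite (negPf op').
Qed.

(** * Generation of the symmetric group *)

Lemma linked_chart6 s : linked (G k) ctr (chart s 6%R) /\ linked (G k) ctr (chart (s + 2)%R 6%R).
Proof.
have rG t : rot t \in G k by rewrite groupM ?rho_G.
have sG t b : spin t b \in G k by case: b; rewrite /= ?groupV groupX.
have TG : cycle3 ctr (chart (s + 2)%R 6%R) (chart s 6%R) \in G k.
  by rewrite -triple_commg //; do !apply: groupR.
have o0 t : ctr != chart t 6%R by rewrite -(chart0 t) chart_neq.
have pq : chart (s + 2)%R 6%R != chart s 6%R.
  apply/eqP => e; have := @charted_meet_chart (s + 2)%R 6%R; rewrite ord3_add => h.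
  by case: h; [exists 6%R | apply: not_per | apply: not_per].
have n1 := o0 s; have n2 := o0 (s + 2)%R.
split; right.
  exists (chart (s + 2)%R 6%R); split; try sneq.
  by rewrite -groupV cycle3V.
by exists (chart s 6%R); split; try sneq.
Qed.

(** As [rho s] preserves the relation and fixes [x], both the centre and its image are linked to
    [x]. *)
Lemma linked_rho s x : rho s x = x -> linked (G k) ctr x -> linked (G k) ctr (rho s ctr).
Proof.
move=> e h; have := linked_act (rho_G s) h; rewrite e => h'.
exact: linked_trans h (linked_sym h').
Qed.

(** Coordinate 6 is that of the fork vertex, k + 3, precisely for [k = 3]. *)
Lemma rho_fix_6 s : k != 3 -> rho (s + 2)%R (chart s 6%R) = chart s 6%R.
Proof.
move=> k3; apply: rho2_chart; apply/negP; try exact: not_per.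
case/dvdzP => q; rewrite /per => e; have [q0|[q0|q0]] : (q = 0 \/ 1 <= q \/ q <= -1)%R by lia.
- by rewrite q0 in e; lia.
- by nia.
- by nia.
Qed.

Lemma linked_rho_ctr s : linked (G k) ctr (rho (s + 2)%R ctr).
Proof.
have [L1 L2] := linked_chart6 s.
case: (eqVneq k 3) => [k3|k3]; last exact: linked_rho (rho_fix_6 s k3) L1.
(* For [k = 3] the period is 12. The link of the centre with [chart (s + 2) 6] is moved by [rho s],
   then by [rho (s + 1)], so that [chart s 2] and [chart s (-1)] become linked through a common
   point; [rho s] turns this into a link of the centre with [chart s 3], which [rho (s + 2)]
   fixes. *)
have nd d : d != 0%R -> (`|d| < 12)%R -> ~~ (per%:Z %| d)%Z.
  move=> d0 dl; apply/negP => /dvdzP[q e]; move: d0 dl; rewrite e /per k3 => d0 dl.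
  have [q0|[q0|q0]] : (q = 0 \/ 1 <= q \/ q <= -1)%R by lia.
  - by rewrite q0 in d0.
  - by lia.
  - by lia.
have fix5 : rho (s + 1)%R (chart (s + 2)%R (-5)%R) = chart (s + 2)%R (-5)%R.
  by have := @rho2_chart (s + 2)%R (-5)%R; rewrite ord3_add => h; apply: h; apply: nd; lia.
have L3 : linked (G k) (chart s 2%R) (chart (s + 2)%R (-5)%R).
  have := linked_act (rho_G s) L2; rewrite -{1}(chart0 s) rho_chart.
  by have := rho1_chart (s + 2)%R 6%R; rewrite ord3_add => ->.
have L4 : linked (G k) (chart s (-1)%R) (chart (s + 2)%R (-5)%R).
  by have := linked_act (rho_G (s + 1)%R) L3; rewrite fix5 rho1_chart.
have := linked_act (rho_G s) (linked_trans L3 (linked_sym L4)).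
rewrite !rho_chart chart0 => L5; apply: linked_rho L5.
by apply: rho2_chart; apply: nd; lia.
Qed.

(** The class of the centre is closed under all generators, so it spreads along the arms and into
    the forks. *)
Lemma linked_all x y : linked (G k) x y.
Proof.
suff L z : linked (G k) ctr z by apply: linked_trans (linked_sym (L x)) (L y).
have Lr s : linked (G k) ctr (rho s ctr).
  by have := linked_rho_ctr (s + 1)%R; rewrite ord3_add.
have step_ s u : linked (G k) ctr u -> linked (G k) ctr (rho s u).
  by move=> h; apply: linked_trans (Lr s) (linked_act (rho_G s) h).
have L0 s : linked (G k) ctr (pt s 0) by rewrite -rho_ctr.
have Lpath s j : j <= 2 * k + 2 -> linked (G k) ctr (pt s j).
  elim: j => [|j IH] hj //; have {}IH := step_ _ _ (IH (ltnW hj)).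
  case: (boolP (odd j)) => oj.
    have := IH s; rewrite rho_pt ?step_sub ?step0; last by lia.
    by rewrite /opt_pt oj; split_ifs.
  have := IH (s + 1)%R; rewrite rho_pt ?step_sub ?step1; last by lia.
  by rewrite /opt_pt (negPf oj); split_ifs.
case: (pointP z) => [->|[s [j [hj ->]]]]; first by left.
case: (leqP j (2 * k + 2)) => [/Lpath //|hj2].
have E := Lpath s _ (leqnn _).
have [->|->] : j = 2 * k + 3 \/ j = 2 * k + 4 by lia.
  have := step_ (s + 2)%R _ E; rewrite rho_pt ?step_sub ?step2; last by lia.
  by rewrite /opt_pt eqxx.
have := step_ (s + 1)%R _ E; rewrite rho_pt ?step_sub ?step1; last by lia.
by rewrite /opt_pt; split_ifs.
Qed.

Lemma G_full : G k = [set: 'S_(deg k)] :> {set _}.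
Proof. by apply: (linked_full linked_all (rho_G 0%R)); exact: rho1_odd. Qed.

(** * Orders of the parabolics *)

Lemma rot_order_dvd s : #[rot s] %| 3 * per.
Proof.
rewrite order_dvdn; apply/eqP/permP => x; rewrite perm1.
case: (chartP s x) => [[r ->]|]; last by apply: rotX6; rewrite /per; apply/dvdnP; exists (k + 3); lia.
by rewrite rotX_chart; apply: chart_per; apply/dvdzP; exists 3%R; lia.
Qed.

Lemma per_dvd_rot_order s : per %| #[rot s].
Proof.
have := @rotX_chart s #[rot s] 0%R; rewrite expg_order perm1 => /esym/chart_inj.
by rewrite add0r subr0.
Qed.

(** The order of [rot s] is a multiple of [per], as seen on the long path, and divides [3 * per], a
    multiple of 6 since [per] is even. The reflections at most double the group. *)
Lemma par_card s : per <= #|par s| <= 6 * per.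
Proof.
apply/andP; split.
  have rs : rot s \in par s by rewrite groupM ?par_id ?par_next.
  apply: leq_trans (dvdn_leq (cardG_gt0 _) (order_dvdG rs)).
  exact: dvdn_leq (order_gt0 _) (per_dvd_rot_order s).
apply: leq_trans (dihedral_card (@rho_invol s) (@rho_invol (s + 1)%R)) _.
have : #[rot s] <= 3 * per by apply: dvdn_leq (rot_order_dvd s); rewrite /per; lia.
by move=> h; rewrite (_ : 6 * per = 3 * per * 2); [rewrite leq_mul2r; exact: h | rewrite /per; lia].
Qed.

End Family.

Theorem theorem6p1 :
  (forall k : nat, (1 <= k)%N ->
    [/\ [/\ is_geometry (Gamma k), thin (Gamma k), flag_transitive (Gamma k)
          & residually_connected (Gamma k)],
        [/\ Autg (Gamma k) \isog G k, G k \isog [set: 'S_(deg k)]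
          & [faithful G k, on [set: Gamma k] | Gamma_action k]]
      & (exists phi : {perm Gamma k}, triality phi)
        /\ ~ (exists phi : {perm Gamma k}, duality phi)])
  /\
  (exists c C : rat, (0 < c)%R /\
     forall k : nat, (1 <= k)%N -> forall i : 'I_3,
       (c * (deg k)%:R <= #|parabolic k i|%:R <= C * (deg k)%:R)%R).
Proof.
split=> [k k1|]; last first.
  (* With [per] = 2k + 6 and degree 6k + 16, the degree is at most [3 * per], and [6 * per] is at
     most three times the degree. *)
  exists (1 / 3%:R)%R, 3%:R%R; split=> // k k1 i.
  have := par_card k1 (i + 1)%R; rewrite -parabolic_par /per => /andP[h1 h2].
  have e : deg k = 16 + 6 * k by [].
  have l1 : deg k <= 3 * #|parabolic k i| by lia.
  have l2 : #|parabolic k i| <= 3 * deg k by lia.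
  move: l1 l2; rewrite -(ler_nat rat) -[(_ <= 3 * _)%N](ler_nat rat) !natrM => l1 l2.
  by apply/andP; split; lra.
have gG := G_gen k; have gH := @parabolic_gen k.
have rn i : rho k i \notin parabolic k i by rewrite parabolic_par rho_notin_par.
have hm i g : g \in parabolic k i -> g \in parabolic k (i + 1)%R ->
    g = 1%g \/ g = rho k (i + 2)%R.
  by rewrite !parabolic_par => h1 h2; have := par_meet k1 h1 h2; rewrite ord3_add.
have hf i g2 g3 : g2 \in parabolic k (i + 1)%R -> g3 \in parabolic k (i + 2)%R ->
    (g2 * g3)%g \in parabolic k i ->
    exists f2 f3, [/\ f2 \in (parabolic k i :&: parabolic k (i + 1)%R)%g,
      f3 \in (parabolic k i :&: parabolic k (i + 2)%R)%g & (g2 * g3 = f2 * f3)%g].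
  rewrite !parabolic_par => h2 h3 h.
  have h3' : g3 \in par k (i + 1 + 2)%R by move: h3; rewrite !ord3_add.
  have [f2 [f3 [e2 e3 e]]] := par_factor k1 h2 h3' h.
  exists f2, f3; split=> //; apply/setIP; split.
  - by case: e2 => ->; rewrite ?group1 ?par_next.
  - by case: e2 => ->; rewrite ?group1 ?par_id.
  - by case: e3 => ->; rewrite ?group1 ?par_id.
  - by case: e3 => ->; rewrite ?group1 //; have := par_next k (i + 2 + 1)%R; rewrite !ord3_add.
split.
- split.
  + exact: coset_is_geometry gG gH hf.
  + exact: coset_thin gG gH rn hm hf.
  + exact: coset_flag_transitive gG gH rn hm hf.
  + exact: coset_residually_connected gG gH hf.
- split.
  + exact: coset_Aut_isog gG gH rn hm hf.
  + by rewrite (G_full k1) isog_refl.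
  + exact: (coset_faithful (G k) rn hm).
split; first by have [phi hphi] := conj_triality gG gH (@rho_turn k); exists phi.
case=> phi /(duality_words gG gH rn hm hf) [i [j [ij hw]]].
case: (ord3_cases i j) ij hw => ->; rewrite ?eqxx // => _ hw.
  by apply: (no_swap k1 (s := i)) hw; rewrite ?tpermL ?tpermR.
(* Here [j = i + 2], so the consecutive pair to exchange starts at [j]: [i = j + 1]. *)
by apply: (no_swap k1 (s := (i + 2)%R)) hw; rewrite ord3_add ?tpermL ?tpermR.
Qed.
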